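(* Let $n,q\in\mathbb{N}$ and $x,a\in\mathbb{R}$ with $a>0$. Let $\chi$ be a Dirichlet character modulo $q$, and let $L(s,x,a,\chi)$ be Berndt's generalized $L$-function. If $q=1$, then $$L(1-n,x,a,\chi)=-\frac{\beta_{n}\bigl(a,e^{\frac{2\pi \mathrm{i}x}{q}}\bigr)}{n},$$ and if $q\geqslant2$, then $$L(1-n,x,a,\chi)=-\frac{\beta_{n,\chi}\bigl(a,e^{\frac{2\pi \mathrm{i}x}{q}}\bigr)}{n},$$ where $\beta_n(\cdot,\cdot)$ are the Apostol-Bernoulli polynomials and $\beta_{n,\chi}(\cdot,\cdot)$ are the generalized Apostol-Bernoulli polynomials.
   Context: $\mathbb{N}$ is the set of positive integers. A Dirichlet character modulo $q$ is extended to $\mathbb{Z}$ in the usual way (zero on integers not coprime to $q$); for $q=1$ it is identically $1$, in particular $\chi(0)=1$. For $x\in\mathbb{R}$, $a>0$ and a Dirichlet character $\chi$ modulo $q$, Berndt's generalized $L$-function is defined for $\Re(s)>1$ by $$L(s,x,a,\chi)=\sum_{k=0}^{\infty}\frac{\chi(k)e^{\frac{2\pi \mathrm{i}kx}{q}}}{(k+a)^{s}},$$ and for other $s$ by analytic continuation (it continues to $\mathbb{C}\setminus\{1\}$ with at most a simple pole at $s=1$). The Apostol-Bernoulli polynomials $\beta_n(y,\lambda)$, $\lambda\in\mathbb{C}\setminus\{0\}$, are defined by the Taylor expansion at $t=0$ $$\frac{te^{yt}}{\lambda e^{t}-1}=\sum_{n=0}^{\infty}\beta_{n}(y,\lambda)\frac{t^{n}}{n!}.$$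 The generalized Apostol-Bernoulli polynomials $\beta_{n,\chi}(y,\lambda)$, for $\lambda\in\mathbb{C}\setminus\{0\}$ and $\chi$ a Dirichlet character modulo $q$, are defined by the Taylor expansion at $t=0$ $$\sum_{r=1}^{q}\frac{\chi(r)\lambda^{r}te^{(r+y)t}}{\lambda^{q}e^{qt}-1}=\sum_{n=0}^{\infty}\beta_{n,\chi}(y,\lambda)\frac{t^{n}}{n!}.$$ (Removable singularities at $t=0$ are filled in.) *)

(* Defs.v *)
From Stdlib Require Import Reals ZArith ClassicalEpsilon.
From Coquelicot Require Import Coquelicot.

Definition Cexp (z : C) : C :=
  ((exp (Re z) * cos (Im z))%R, (exp (Re z) * sin (Im z))%R).

(* b ^ s for a positive real b, with the real logarithm of b. *)
Definition Rcpow (b : R) (s : C) : C := Cexp (s * RtoC (ln b))%C.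

(* Dirichlet characters modulo q >= 1, already extended to Z.  For q = 1 the
   third clause makes chi nonzero everywhere, so chi is identically 1. *)
Record dirichlet_character (q : nat) (chi : Z -> C) : Prop := {
  dirichlet_periodic : forall k : Z, chi (k + Z.of_nat q)%Z = chi k;
  dirichlet_mult : forall k l : Z, chi (k * l)%Z = (chi k * chi l)%C;
  dirichlet_zero : forall k : Z, chi k = 0%C <-> Z.gcd k (Z.of_nat q) <> 1%Z
}.

Definition analytic_at (F : C -> C) (z0 : C) : Prop :=
  exists (c : nat -> C) (r : R), (0 < r)%R /\
    forall z : C, (Cmod (z - z0) < r)%R ->
      is_pseries (K := C_AbsRing) (V := C_NormedModule) c (z - z0)%C (F z).

Definition berndt_term (q : nat) (x a : R) (chi : Z -> C) (s : C) (k : nat) : C :=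
  (chi (Z.of_nat k) *
   Cexp (2 * RtoC PI * Ci * RtoC (INR k) * RtoC x / RtoC (INR q)) /
   Rcpow (INR k + a) s)%C.

Definition is_berndt_L (q : nat) (x a : R) (chi : Z -> C) (F : C -> C) : Prop :=
  (forall s : C, (1 < Re s)%R ->
     is_series (K := C_AbsRing) (V := C_NormedModule)
       (berndt_term q x a chi s) (F s)) /\
  (forall s : C, s <> RtoC 1 -> analytic_at F s).

(* By the identity theorem on the connected set C \ {1}, [is_berndt_L]
   determines F there; the value at s = 1 is unspecified. *)
Definition berndt_L (q : nat) (x a : R) (chi : Z -> C) : C -> C :=
  epsilon (inhabits (fun _ : C => RtoC 0)) (is_berndt_L q x a chi).

(* Only nonzero t are constrained, so f may have a removable singularity at 0. *)
Definition is_taylor_at0 (f : C -> C) (c : nat -> C) : Prop :=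
  exists r : R, (0 < r)%R /\
    forall t : C, t <> RtoC 0 -> (Cmod t < r)%R ->
      is_pseries (K := C_AbsRing) (V := C_NormedModule) c t (f t).

(* Coefficient of t ^ n / n! in the expansion of f at 0. *)
Definition egf_coef (f : C -> C) (n : nat) : C :=
  (RtoC (INR (fact n)) *
   epsilon (inhabits (fun _ : nat => RtoC 0)) (is_taylor_at0 f) n)%C.

Definition apostol_bernoulli (n : nat) (y lambda : C) : C :=
  egf_coef (fun t : C => t * Cexp (y * t) / (lambda * Cexp t - 1))%C n.

Definition gen_apostol_bernoulli (n q : nat) (chi : Z -> C) (y lambda : C) : C :=
  egf_coef (fun t : C =>
    sum_n_m (G := C_AbelianMonoid) (fun r : nat =>
      (chi (Z.of_nat r) * lambda ^ r * t * Cexp ((RtoC (INR r) + y) * t) /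
       (lambda ^ q * Cexp (RtoC (INR q) * t) - 1))%C) 1 q) n.

(* Main.v *)
Require Import Defs.
From Stdlib Require Import Reals ZArith Lra Lia ClassicalEpsilon.
From Coquelicot Require Import Coquelicot.

(** The values at [1 - n] come from Euler-Maclaurin summation, with an operator that
    is the same power series as the generating function of the Apostol-Bernoulli
    polynomials.

    Put [lam = exp (2 pi i x / q)] and [mu = lam ^ q]. Split by residues modulo [q],
    the L-series is a combination of series of [mu ^ m * u ^ (- s)] over arithmetic
    progressions [u = b + q m], with [b = r + a]. Up to the factor [1 - s] the general
    term is the derivative of [u ^ w], where [w = 1 - s]. Let
    [t / (1 - mu * exp (q t))] be the sum of [P j * t ^ j], and let [D = d / du]. As
    [exp (q D)] is the translation by [q], the function
    [Psi (u) = sum of P j * D ^ j (u ^ w) for j <= N] satisfies, by Taylor's formula,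
    [Psi (u) - mu * Psi (u + q) = D (u ^ w) + error] with an error of order
    [u ^ (Re w - N - 1)] ([em_rem_bound]). Summing over the progression, the left side
    telescopes to [Psi (b)] and the errors converge absolutely when [Re w < N]. This
    defines a regularised sum [em_value], which is independent of [N], agrees with the
    series for [Re w < 0] ([em_value_series]), and is entire in [w]
    ([expandable_em_value]). Dividing by [1 - s] gives the continuation.

    At [w = n] the function [u ^ n] is a polynomial, so the error is zero once [N > n],
    and the regularised sum is [Psi (b)], that is [n!] times the coefficient of [t ^ n]
    in [t * exp (b t) / (1 - mu * exp (q t))] ([em_value_nat]). Up to sign this is the
    generating function of the theorem; the division by [1 - s = n] gives the formula.
    The cases [mu = 1], where the continuation may have a pole at [s = 1], and
    [mu <> 1] are treated alike, because the factor [t] absorbs the pole of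
    [1 / (1 - mu * exp (q t))] at [0].

    The L-function and the Taylor coefficients are picked by a choice operator among
    the functions, respectively sequences, with the defining property, so existence and
    uniqueness are both part of the proof. Uniqueness is the identity theorem
    ([is_berndt_L_unique]) and the uniqueness of power series ([powser_unique]).
    Existence rests on Weierstrass' theorem for series of power series ([weierstrass]),
    obtained from a Cauchy estimate in which averages over roots of unity replace
    contour integrals ([cauchy_estimate]). *)

(** * Complex series *)

Notation cseries := (is_series (K := C_AbsRing) (V := C_NormedModule)).

Fixpoint csum (f : nat -> C) (n : nat) : C :=
  match n with O => 0%C | S m => (csum f m + f m)%C end.

Lemma csum_ext f g n : (forall k, (k < n)%nat -> f k = g k) -> csum f n = csum g n.
Proof.
induction n as [|n IH]; intros H; simpl; auto.
rewrite IH, H by (intros; auto with arith); reflexivity.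
Qed.

Lemma csum_plus f g n : csum (fun k => f k + g k)%C n = (csum f n + csum g n)%C.
Proof. induction n as [|n IH]; simpl; [|rewrite IH]; ring. Qed.

Lemma csum_scal c f n : csum (fun k => c * f k)%C n = (c * csum f n)%C.
Proof. induction n as [|n IH]; simpl; [|rewrite IH]; ring. Qed.

Lemma csum_zero (f : nat -> C) n : (forall k, (k < n)%nat -> f k = 0%C) -> csum f n = 0%C.
Proof.
intros H; rewrite (csum_ext _ (fun k => 0 * 0)%C), csum_scal by (intros; rewrite H; auto; ring).
ring.
Qed.

Lemma csum_one (f : nat -> C) n j : (j < n)%nat -> (forall k, (k < n)%nat -> k <> j -> f k = 0%C) ->
  csum f n = f j.
Proof.
induction n as [|n IH]; intros Hj H; [lia|simpl].
destruct (Nat.eq_dec j n) as [->|Hn].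
- rewrite csum_zero by (intros; apply H; lia). ring.
- rewrite IH, (H n) by (try lia; intros; apply H; lia). ring.
Qed.

Lemma csum_S_head f n : csum f (S n) = (f 0%nat + csum (fun k => f (S k)) n)%C.
Proof. induction n as [|n IH]; [simpl; ring|]. change (csum f (S (S n))) with (csum f (S n) + f (S n))%C. rewrite IH; simpl; ring. Qed.

Lemma csum_add f n m : csum f (n + m) = (csum f n + csum (fun k => f (n + k)%nat) m)%C.
Proof.
induction m as [|m IH]; [rewrite Nat.add_0_r; simpl; ring|].
rewrite Nat.add_succ_r; simpl; rewrite IH; ring.
Qed.

Lemma sum_n_csum (f : nat -> C) n : sum_n (G := C_AbelianMonoid) f n = csum f (S n).
Proof.
induction n as [|n IH]; [rewrite sum_O; simpl; ring|].
rewrite sum_Sn, IH; reflexivity.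
Qed.

Lemma sum_f_R0_csum (f : nat -> R) n : RtoC (sum_f_R0 f n) = csum (fun k => RtoC (f k)) (S n).
Proof.
induction n as [|n IH]; [simpl; ring|].
simpl sum_f_R0; rewrite RtoC_plus, IH; reflexivity.
Qed.

Lemma cseries_eps (a : nat -> C) (l : C) : cseries a l <->
  forall eps, 0 < eps -> exists N, forall n, (N <= n)%nat -> Cmod (csum a n - l) < eps.
Proof.
pose proof (filterlim_locally_ball_norm (U := C_NormedModule) (F := eventually) (sum_n a) l) as E.
unfold is_series; split; intros H.
- pose proof (proj1 E H) as H0; clear H; rename H0 into H; intros eps He; destruct (H (mkposreal eps He)) as [N HN]; exists (S N); intros [|n] Hn; [lia|].
  rewrite <- sum_n_csum; apply (HN n); lia.
- apply (proj2 E); intros [eps He]; destruct (H eps He) as [N HN]; exists N; intros n Hn.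
  specialize (HN (S n)); rewrite <- sum_n_csum in HN; apply HN; lia.
Qed.

Lemma cseries_unique (a : nat -> C) (l l' : C) : cseries a l -> cseries a l' -> l = l'.
Proof. intros H H'; apply (filterlim_locally_unique (sum_n a) l l' H H'). Qed.

Lemma Cmod_csum f n : Cmod (csum f n) <= Re (csum (fun k => RtoC (Cmod (f k))) n).
Proof.
induction n as [|n IH]; simpl; [rewrite Cmod_0; lra|].
eapply Rle_trans; [apply Cmod_triangle|]; simpl in *. unfold Re in *; lra.
Qed.

Lemma csum_le_const f n M : (forall k, (k < n)%nat -> Cmod (f k) <= M) -> Cmod (csum f n) <= INR n * M.
Proof.
induction n as [|n IH]; intros H; [simpl; rewrite Cmod_0; lra|].
rewrite S_INR; simpl; eapply Rle_trans; [apply Cmod_triangle|].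
generalize (IH (fun k hk => H k ltac:(lia))) (H n ltac:(lia)); lra.
Qed.

Lemma cseries_plus (a b : nat -> C) (la lb : C) : cseries a la -> cseries b lb ->
  cseries (fun n => a n + b n)%C (la + lb)%C.
Proof. exact (is_series_plus a b la lb). Qed.

Lemma cseries_scal (c : C) (a : nat -> C) (la : C) : cseries a la -> cseries (fun n => c * a n)%C (c * la)%C.
Proof. exact (is_series_scal c a la). Qed.

Lemma cseries_ext (a b : nat -> C) (l : C) : (forall n, a n = b n) -> cseries a l -> cseries b l.
Proof. exact (is_series_ext a b l). Qed.

Lemma cseries_finite (a : nat -> C) n : (forall k, (n <= k)%nat -> a k = 0%C) -> cseries a (csum a n).
Proof.
intros H; apply cseries_eps; intros eps He; exists n; intros m Hm.
replace m with (n + (m - n))%nat by lia; rewrite csum_add.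
rewrite (csum_zero (fun k => a (n + k)%nat)) by (intros; apply H; lia).
replace (_ - _)%C with (RtoC 0) by ring; rewrite Cmod_0; lra.
Qed.

Lemma cseries_csum (a : nat -> nat -> C) (l : nat -> C) n :
  (forall i, (i < n)%nat -> cseries (a i) (l i)) ->
  cseries (fun k => csum (fun i => a i k) n) (csum l n).
Proof.
induction n as [|n IH]; intros H.
- apply (cseries_finite (fun _ => RtoC 0) 0); auto.
- apply cseries_plus; auto.
Qed.

Lemma ex_cseries_le (a : nat -> C) (b : nat -> R) :
  (forall n, Cmod (a n) <= b n) -> ex_series b -> exists l : C, cseries a l.
Proof. intros H Hb; exact (ex_series_le (V := C_CompleteNormedModule) a b H Hb). Qed.

Lemma ex_rseries_le (a b : nat -> R) :
  (forall n, 0 <= a n <= b n) -> ex_series b -> ex_series a.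
Proof.
intros H Hb; apply (ex_series_le (V := R_CompleteNormedModule) a b); auto.
intros n; change (Rabs (a n) <= b n); rewrite Rabs_pos_eq; apply H.
Qed.

Lemma ex_rseries_scal (c : R) (a : nat -> R) : ex_series a -> ex_series (fun n => c * a n).
Proof. exact (ex_series_scal_l c a). Qed.

Lemma Series_nonneg a : (forall n, 0 <= a n) -> ex_series a -> 0 <= Series a.
Proof.
intros H Ha; rewrite <- (Rmult_0_l (Series a)), <- Series_scal_l.
apply Series_le; auto; intros n; specialize (H n); nra.
Qed.

Lemma Series_tail_small b eps : (forall n, 0 <= b n) -> ex_series b -> 0 < eps ->
  exists N, forall n, (N <= n)%nat -> Series (fun k => b (n + k)%nat) < eps.
Proof.
intros Hb Eb He.
pose proof (Series_correct b Eb) as H.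
apply is_series_Reals in H.
destruct (H eps He) as [N HN]; exists (S N); intros n Hn.
rewrite (Series_incr_n b n ltac:(lia) Eb) in HN.
specialize (HN (pred n) ltac:(lia)); unfold Rdist in HN.
apply Rle_lt_trans with (2 := HN).
rewrite Rabs_minus_sym; eapply Rle_trans; [|apply Rle_abs]; lra.
Qed.

Lemma cseries_le a b l : (forall n, Cmod (a n) <= b n) -> ex_series b -> cseries a l ->
  Cmod l <= Series b.
Proof.
intros H Hb Ha; apply le_epsilon; intros eps He.
destruct (proj1 (cseries_eps a l) Ha eps He) as [N HN].
specialize (HN (S N) ltac:(lia)).
assert (B : forall n, 0 <= b n) by (intros n; eapply Rle_trans; [apply Cmod_ge_0|apply H]).
replace l with (csum a (S N) + - (csum a (S N) - l))%C by ring.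
eapply Rle_trans; [apply Cmod_triangle|]; rewrite Cmod_opp.
assert (Cmod (csum a (S N)) <= Series b); [|lra].
eapply Rle_trans; [apply Cmod_csum|].
apply Rle_trans with (sum_f_R0 b N).
- rewrite <- sum_f_R0_csum; simpl; apply sum_Rle; auto.
- rewrite (Series_incr_n b (S N)) by (auto with arith; lia); simpl.
  generalize (Series_nonneg (fun k => b (S N + k)%nat) (fun n => B _) (proj1 (ex_series_incr_n b (S N)) Hb)).
  simpl; lra.
Qed.

Lemma cseries_tail_le a b l n : (forall n, Cmod (a n) <= b n) -> ex_series b -> cseries a l ->
  Cmod (l - csum a n) <= Series (fun k => b (n + k)%nat).
Proof.
intros H Hb Ha; apply cseries_le with (a := fun k => a (n + k)%nat); auto.
- now apply (ex_series_incr_n b n).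
- apply cseries_eps; intros eps He; destruct (proj1 (cseries_eps a l) Ha eps He) as [N HN].
  exists N; intros m Hm; specialize (HN (n + m)%nat ltac:(lia)); rewrite csum_add in HN.
  eapply Rle_lt_trans; [right; apply (f_equal Cmod)|exact HN]; ring.
Qed.

(** The domination by a product makes the error explicit: after [n] columns it is
    at most [Series A] times the tail of [Series B]. *)
Lemma cseries_switch (a : nat -> nat -> C) (A B : nat -> R) r c total :
  (forall m k, Cmod (a m k) <= A m * B k) ->
  (forall m, 0 <= A m) -> (forall k, 0 <= B k) -> ex_series A -> ex_series B ->
  (forall m, cseries (a m) (r m)) -> (forall k, cseries (fun m => a m k) (c k)) ->
  cseries r total -> cseries c total.
Proof.
intros H HA HB EA EB Hr Hc HS; apply cseries_eps; intros eps He.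
destruct (Series_tail_small B (eps / (Series A + 1)) HB EB) as [N HN].
{ apply Rdiv_lt_0_compat; auto; generalize (Series_nonneg A HA EA); lra. }
exists N; intros n Hn.
pose proof (Series_nonneg A HA EA) as PA.
assert (X : cseries (fun m => csum (a m) n) (csum c n)).
{ apply (cseries_csum (fun k m => a m k)); auto. }
replace (csum c n - total)%C with (-(total + -(1) * csum c n))%C by ring; rewrite Cmod_opp.
set (T := Series (fun k => B (n + k)%nat)) in *.
assert (T < eps / (Series A + 1)) by (apply HN; auto).
assert (0 <= T).
{ apply Series_nonneg; auto; now apply (ex_series_incr_n B n). }
apply Rle_lt_trans with (Series A * T).
- rewrite <- Series_scal_r.
  apply cseries_le with (a := fun m => (r m + -(1) * csum (a m) n)%C).
  + intros m; unfold T; rewrite <- Series_scal_l.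
    replace (_ + _)%C with (r m - csum (a m) n)%C by ring.
    apply (cseries_tail_le (a m) (fun k => A m * B k) (r m) n); auto.
    now apply (ex_series_scal_l (A m) B).
  + now apply (ex_series_scal_r T A).
  + apply cseries_plus; auto; now apply cseries_scal.
- apply Rle_lt_trans with (Series A * (eps / (Series A + 1))).
  + apply Rmult_le_compat_l; lra.
  + unfold Rdiv; rewrite <- Rmult_assoc. apply Rmult_lt_reg_r with (Series A + 1); [lra|].
    rewrite Rmult_assoc, Rinv_l by lra; nra.
Qed.

(** * Functions given by a power series on a disc *)

Definition powser (c : nat -> C) (rho : R) (f : C -> C) : Prop :=
  forall z : C, Cmod z < rho -> cseries (fun k => c k * z ^ k)%C (f z).

Lemma pow_n_Cpow (z : C) k : pow_n (K := C_Ring) z k = (z ^ k)%C.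
Proof. induction k as [|k IH]; simpl; [reflexivity|]. rewrite IH; reflexivity. Qed.

Lemma is_pseries_C (c : nat -> C) (z l : C) :
  is_pseries (K := C_AbsRing) (V := C_NormedModule) c z l <-> cseries (fun k => c k * z ^ k)%C l.
Proof.
assert (E : forall k, scal (K := C_AbsRing) (V := C_NormedModule) (pow_n z k) (c k) = (c k * z ^ k)%C).
{ intros k; transitivity (pow_n (K := C_Ring) z k * c k)%C; [reflexivity|].
  rewrite pow_n_Cpow; apply Cmult_comm. }
unfold is_pseries; split; apply cseries_ext; intros k; rewrite E; reflexivity.
Qed.

Lemma powser_ext c rho f g : (forall z, Cmod z < rho -> f z = g z) -> powser c rho f -> powser c rho g.
Proof. intros E H z Hz; rewrite <- E; auto. Qed.

Lemma powser_sub c rho R1 f : R1 <= rho -> powser c rho f -> powser c R1 f.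
Proof. intros L H z Hz; apply H; lra. Qed.

Lemma cseries_bounded a l : cseries a l -> exists M, forall n, Cmod (a n) <= M.
Proof.
intros H; destruct (proj1 (cseries_eps a l) H 1 Rlt_0_1) as [N HN].
assert (B : exists M, 0 <= M /\ forall n, (n < N)%nat -> Cmod (a n) <= M).
{ clear; induction N as [|N [M [M0 HM]]]; [exists 0; split; [lra|lia]|].
  exists (M + Cmod (a N)); generalize (Cmod_ge_0 (a N)); split; [lra|].
  intros n Hn; destruct (Nat.eq_dec n N) as [->|]; [lra|].
  generalize (HM n ltac:(lia)); lra. }
destruct B as [M [M0 HM]]; exists (M + 2); intros n; destruct (Nat.lt_ge_cases n N) as [L|L].
- generalize (HM n L); lra.
- generalize (HN n L) (HN (S n) ltac:(lia)); simpl; intros H1 H2.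
  replace (a n) with ((csum a n + a n - l) + - (csum a n - l))%C by ring.
  eapply Rle_trans; [apply Cmod_triangle|]; rewrite Cmod_opp; lra.
Qed.

Lemma ex_series_geom_scal M x : 0 <= x < 1 -> ex_series (fun k => M * x ^ k).
Proof. intros H; apply (ex_series_scal_l M (fun k => x ^ k)), ex_series_geom; rewrite Rabs_pos_eq; lra. Qed.

Lemma Rdiv_pow_le x y n : 0 <= x -> 0 < y -> x ^ n = y ^ n * (x / y) ^ n.
Proof. intros Hx Hy; rewrite <- Rpow_mult_distr; f_equal; field; lra. Qed.

(** Convergence at a point of larger modulus bounds the terms there, and the ratio
    of the two moduli then gives a geometric majorant. *)
Lemma powser_abs c rho f r : powser c rho f -> 0 <= r < rho ->
  ex_series (fun k => Cmod (c k) * r ^ k).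
Proof.
intros H Hr; set (r' := (r + rho) / 2).
assert (A : r < r' < rho) by (unfold r'; lra).
destruct (cseries_bounded _ _ (H (RtoC r') ltac:(rewrite Cmod_R, Rabs_pos_eq; lra))) as [M HM].
apply ex_rseries_le with (fun k => M * (r / r') ^ k).
- intros k; split; [apply Rmult_le_pos; [apply Cmod_ge_0|apply pow_le; lra]|].
  rewrite (Rdiv_pow_le r r') by lra; rewrite <- Rmult_assoc.
  apply Rmult_le_compat_r; [apply pow_le, Rdiv_le_0_compat; lra|].
  specialize (HM k); rewrite Cmod_mult, Cmod_pow, Cmod_R, Rabs_pos_eq in HM by lra; auto.
- apply ex_series_geom_scal; split; [apply Rdiv_le_0_compat; lra|].
  apply Rmult_lt_reg_r with r'; [lra|]; unfold Rdiv; rewrite Rmult_assoc, Rinv_l; lra.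
Qed.

Lemma ex_series_shift_pow (b : nat -> R) r n : 0 < r -> ex_series (fun k => b k * r ^ k) ->
  ex_series (fun k => b (n + k)%nat * r ^ k).
Proof.
intros Hr H; apply (ex_series_incr_n _ n) in H.
apply (ex_series_scal_l (V := R_NormedModule) (/ r ^ n)) in H; revert H; apply ex_series_ext; intros k.
change (/ r ^ n * (b (n + k)%nat * r ^ (n + k)) = b (n + k)%nat * r ^ k).
rewrite pow_add; field; apply pow_nonzero; lra.
Qed.

(** The bound is linear in [Cmod z ^ n]: with [n = 0] it says that the function is
    bounded on smaller discs, with [n = 1] that it is continuous at the centre, and
    with [n = S k] it isolates the first nonzero coefficient. *)
Lemma powser_tail_bound c rho f r n : powser c rho f -> 0 < r < rho ->
  exists B, 0 <= B /\ forall z, Cmod z <= r ->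
    Cmod (f z - csum (fun k => c k * z ^ k)%C n) <= Cmod z ^ n * B.
Proof.
intros H Hr; pose proof (powser_abs c rho f r H ltac:(lra)) as E.
pose proof (ex_series_shift_pow (fun k => Cmod (c k)) r n ltac:(lra) E) as E'.
exists (Series (fun k => Cmod (c (n + k)%nat) * r ^ k)); split.
{ apply Series_nonneg; auto; intros k; apply Rmult_le_pos; [apply Cmod_ge_0|apply pow_le; lra]. }
intros z Hz; pose proof (Cmod_ge_0 z) as Z0.
rewrite <- Series_scal_l.
(* Comparison with the series at the fixed radius [r]. *)
assert (T : forall k, 0 <= Cmod z ^ n * (Cmod (c (n + k)%nat) * Cmod z ^ k) <=
   Cmod z ^ n * (Cmod (c (n + k)%nat) * r ^ k)).
{ intros k; split; [repeat apply Rmult_le_pos; try apply pow_le; try apply Cmod_ge_0|].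
  apply Rmult_le_compat_l; [apply pow_le; auto|].
  apply Rmult_le_compat_l; [apply Cmod_ge_0|]; apply pow_incr; lra. }
eapply Rle_trans; [|apply Series_le; [exact T|exact (ex_series_scal_l _ _ E')]].
eapply Rle_trans; [apply (cseries_tail_le _ (fun k => Cmod (c k) * Cmod z ^ k))|].
- intros k; rewrite Cmod_mult, Cmod_pow; lra.
- apply ex_rseries_le with (2 := E); intros k; split;
  [apply Rmult_le_pos; [apply Cmod_ge_0|apply pow_le; lra]|].
  apply Rmult_le_compat_l; [apply Cmod_ge_0|]; apply pow_incr; lra.
- apply H; lra.
- right; apply Series_ext; intros k; rewrite pow_add; ring.
Qed.

(** At a small zero [z] the first nonzero term [c k * z ^ k] must be balanced by a
    tail of order [Cmod z ^ S k], which is impossible as [z] tends to [0]. *)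
Lemma powser_zero c rho f : 0 < rho -> powser c rho f ->
  (forall eps, 0 < eps -> exists z : C, z <> RtoC 0 /\ Cmod z < eps /\ f z = RtoC 0) ->
  forall k, c k = RtoC 0.
Proof.
intros HR H Hz k; induction k as [k IH] using lt_wf_ind.
destruct (powser_tail_bound c rho f (rho / 2) (S k) H ltac:(lra)) as [B [B0 HB]].
apply Cmod_eq_0, Rle_antisym; [|apply Cmod_ge_0].
apply le_epsilon; intros eps He; rewrite Rplus_0_l.
destruct (Hz (Rmin (rho / 2) (eps / (B + 1)))) as (z & z0 & zl & fz).
{ apply Rmin_pos; [lra|]; apply Rdiv_lt_0_compat; lra. }
pose proof (Rmin_l (rho / 2) (eps / (B + 1))) as L1.
pose proof (Rmin_r (rho / 2) (eps / (B + 1))) as L2.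
pose proof (proj1 (Cmod_gt_0 z) z0) as Zp.
specialize (HB z ltac:(lra)); rewrite fz in HB; simpl csum in HB.
rewrite csum_zero in HB by (intros j Hj; rewrite IH by auto; ring).
replace (0 - (0 + c k * z ^ k))%C with (- (c k * z ^ k))%C in HB by ring.
rewrite Cmod_opp, Cmod_mult, Cmod_pow in HB; simpl in HB.
assert (Q : Cmod (c k) <= Cmod z * B).
{ apply Rmult_le_reg_r with (Cmod z ^ k); [now apply pow_lt|]. lra. }
assert (Cmod z * (B + 1) <= eps); [|nra].
apply Rle_trans with (eps / (B + 1) * (B + 1)); [apply Rmult_le_compat_r; lra|].
right; field; lra.
Qed.

Lemma cseries_eq (a : nat -> C) (l l' : C) : l = l' -> cseries a l -> cseries a l'.
Proof. now intros ->. Qed.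

Lemma powser_plus c d rho f g : powser c rho f -> powser d rho g ->
  powser (fun k => c k + d k)%C rho (fun z => f z + g z)%C.
Proof.
intros Hf Hg z Hz; eapply cseries_ext; [|exact (cseries_plus _ _ _ _ (Hf z Hz) (Hg z Hz))].
intros n; simpl; ring.
Qed.

Lemma powser_scal a c rho f : powser c rho f ->
  powser (fun k => a * c k)%C rho (fun z => a * f z)%C.
Proof.
intros Hf z Hz; eapply cseries_ext; [|exact (cseries_scal a _ _ (Hf z Hz))].
intros n; simpl; ring.
Qed.

Lemma powser_minus c d rho f g : powser c rho f -> powser d rho g ->
  powser (fun k => c k - d k)%C rho (fun z => f z - g z)%C.
Proof.
intros Hf Hg; pose proof (powser_plus _ _ _ _ _ Hf (powser_scal (-(1))%C _ _ _ Hg)) as H.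
intros z Hz; eapply cseries_ext; [|eapply cseries_eq; [|exact (H z Hz)]].
intros n; simpl; ring. simpl; ring.
Qed.

(** The origin is left out of the hypothesis so that the lemma also applies to
    functions that are only specified off a removable singularity. *)
Lemma powser_unique c d rho f g : 0 < rho -> powser c rho f -> powser d rho g ->
  (forall z, z <> RtoC 0 -> Cmod z < rho -> f z = g z) -> forall k, c k = d k.
Proof.
intros HR Hf Hg E k; apply Ceq_minus.
apply (powser_zero _ rho _ HR (powser_minus _ _ _ _ _ Hf Hg)).
intros eps He; exists (RtoC (Rmin eps rho / 2)).
pose proof (Rmin_l eps rho); pose proof (Rmin_r eps rho).
assert (0 < Rmin eps rho) by (apply Rmin_pos; lra).
assert (Z : RtoC (Rmin eps rho / 2) <> RtoC 0) by (intros Q; apply RtoC_inj in Q; lra).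
assert (Y : Cmod (RtoC (Rmin eps rho / 2)) = Rmin eps rho / 2)
 by (rewrite Cmod_R, Rabs_pos_eq; lra).
split; auto; split; [lra|].
rewrite E; [ring|auto|lra].
Qed.

Lemma powser_mulX c rho f : powser c rho f ->
  powser (fun k => match k with O => RtoC 0 | S j => c j end) rho (fun z => z * f z)%C.
Proof.
intros H z Hz; apply cseries_eps; intros eps He.
destruct (proj1 (cseries_eps _ _) (cseries_scal z _ _ (H z Hz)) eps He) as [N HN].
exists (S N); intros [|n] Hn; [lia|]; rewrite csum_S_head.
eapply Rle_lt_trans; [right; apply (f_equal Cmod)|exact (HN n ltac:(lia))].
rewrite (csum_ext (fun k => c k * z ^ S k)%C (fun k => z * (c k * z ^ k))%C)
  by (intros; simpl; ring).
ring.
Qed.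

Lemma powser_const a rho : powser (fun k => match k with O => a | _ => RtoC 0 end) rho (fun _ => a).
Proof.
intros z _; eapply cseries_eq; [|apply cseries_finite with (n := 1%nat)]; [simpl; ring|].
intros [|k] Hk; [lia|ring].
Qed.

Lemma powser_id rho : powser (fun k => match k with 1%nat => RtoC 1 | _ => RtoC 0 end) rho (fun z => z).
Proof.
intros z _; eapply cseries_eq; [|apply cseries_finite with (n := 2%nat)]; [simpl; ring|].
intros [|[|k]] Hk; try lia; ring.
Qed.

Lemma powser_csum (c : nat -> nat -> C) rho (f : nat -> C -> C) n :
  (forall i, (i < n)%nat -> powser (c i) rho (f i)) ->
  powser (fun k => csum (fun i => c i k) n) rho (fun z => csum (fun i => f i z) n).
Proof.
induction n as [|n IH]; intros H.
- intros z _; eapply cseries_eq; [|apply (cseries_finite _ 0)]; [reflexivity|]; intros; simpl; ring.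
- simpl; apply powser_plus; auto.
Qed.

(** * The complex exponential and roots of unity *)

Lemma Cexp_plus a b : Cexp (a + b) = (Cexp a * Cexp b)%C.
Proof.
unfold Cexp, Cmult, Re, Im; simpl; rewrite exp_plus, cos_plus, sin_plus.
f_equal; ring.
Qed.

Lemma Cexp_RtoC x : Cexp (RtoC x) = RtoC (exp x).
Proof. unfold Cexp, RtoC, Re, Im; simpl; rewrite cos_0, sin_0; f_equal; ring. Qed.

Lemma Cexp_0 : Cexp 0 = RtoC 1.
Proof. rewrite Cexp_RtoC, exp_0; reflexivity. Qed.

Lemma Cmod_Cexp z : Cmod (Cexp z) = exp (Re z).
Proof.
unfold Cmod, Cexp; simpl.
replace (_ + _) with (exp (Re z) ^ 2).
- rewrite sqrt_pow2; auto; left; apply exp_pos.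
- generalize (sin2_cos2 (Im z)); unfold Rsqr; intros H.
  transitivity (exp (Re z) ^ 2 * (sin (Im z) * sin (Im z) + cos (Im z) * cos (Im z))); [rewrite H|]; ring.
Qed.

Lemma Cexp_nonzero z : Cexp z <> RtoC 0.
Proof. apply Cmod_gt_0; rewrite Cmod_Cexp; apply exp_pos. Qed.

Lemma Cexp_opp z : (Cexp (- z) = / Cexp z)%C.
Proof.
assert (E : (Cexp z * Cexp (- z))%C = RtoC 1) by (rewrite <- Cexp_plus, <- Cexp_0; f_equal; ring).
generalize (Cexp_nonzero z); intros N.
replace (Cexp (- z)) with (/ Cexp z * (Cexp z * Cexp (- z)))%C by (field; auto).
rewrite E; ring.
Qed.

Lemma Cexp_pow z n : (Cexp z ^ n = Cexp (RtoC (INR n) * z))%C.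
Proof.
induction n as [|n IH].
- simpl; rewrite <- Cexp_0; f_equal; ring.
- rewrite Cpow_S, IH, <- Cexp_plus, S_INR, RtoC_plus; f_equal; ring.
Qed.

Definition cis (t : R) : C := Cexp (0, t)%R.

Lemma cis_pow t n : (cis t ^ n)%C = cis (INR n * t).
Proof. unfold cis; rewrite Cexp_pow; f_equal; unfold Cmult; simpl; f_equal; ring. Qed.

Lemma cis_plus a b : cis (a + b) = (cis a * cis b)%C.
Proof. unfold cis; rewrite <- Cexp_plus; f_equal; unfold Cplus; simpl; f_equal; ring. Qed.

Lemma Cmod_cis t : Cmod (cis t) = 1.
Proof. unfold cis; rewrite Cmod_Cexp; simpl; apply exp_0. Qed.

Lemma cis_2PI n : cis (2 * PI * INR n) = RtoC 1.
Proof.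
replace (2 * PI * INR n) with (INR n * (2 * PI)) by ring; rewrite <- cis_pow.
replace (cis (2 * PI)) with (RtoC 1); [apply Cpow_1_l|].
unfold cis, Cexp, RtoC; simpl; rewrite cos_2PI, sin_2PI, exp_0; f_equal; ring.
Qed.

Lemma cis_opp a : (cis (- a) * cis a)%C = RtoC 1.
Proof. rewrite <- cis_plus; replace (- a + a) with 0 by ring; unfold cis; exact Cexp_0. Qed.

Lemma cis_neq_1 t : 0 < Rabs t < 2 * PI -> cis t <> RtoC 1.
Proof.
intros Ht E; apply (f_equal Re) in E; unfold cis, Cexp in E; simpl in E.
rewrite exp_0, Rmult_1_l in E.
assert (P : 0 < Rabs t) by lra.
assert (E' : cos (Rabs t) = 1) by (unfold Rabs; destruct Rcase_abs; rewrite ?cos_neg; auto).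
replace (Rabs t) with (2 * (Rabs t / 2)) in E' by field.
rewrite cos_2a_sin in E'.
assert (S0 : 0 < sin (Rabs t / 2)) by (apply sin_gt_0; lra).
nra.
Qed.

Lemma geom_csum (z : C) n : ((z - 1) * csum (fun j => z ^ j) n = z ^ n - 1)%C.
Proof.
induction n as [|n IH]; [simpl; ring|].
simpl csum; replace ((z - 1) * (csum (fun j => z ^ j) n + z ^ n))%C
 with ((z - 1) * csum (fun j => z ^ j) n + (z - 1) * z ^ n)%C by ring.
rewrite IH, Cpow_S; ring.
Qed.

(** The ratio of this geometric sum is an [n]-th root of unity, and it differs from
    [1] because [l - k] is not a multiple of [n]. *)
Lemma root_average n k l : (k < n)%nat -> (l < n)%nat -> l <> k ->
  csum (fun j => cis (2 * PI * (INR l - INR k) / INR n) ^ j)%C n = RtoC 0.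
Proof.
intros Hk Hl Hlk; set (t := 2 * PI * (INR l - INR k) / INR n).
assert (Hn : 0 < INR n) by (apply lt_0_INR; lia).
assert (N : cis t <> RtoC 1).
{ apply cis_neq_1; unfold t.
  assert (A : 0 < Rabs (INR l - INR k) < INR n).
  { split.
    - apply Rabs_pos_lt; intros Q; apply Hlk, INR_eq; lra.
    - apply lt_INR in Hk; apply lt_INR in Hl.
      generalize (pos_INR k) (pos_INR l); intros; apply Rabs_def1; lra. }
  generalize PI_RGT_0; intros HP.
  replace (2 * PI * (INR l - INR k) / INR n) with ((2 * PI / INR n) * (INR l - INR k)) by (field; lra).
  rewrite Rabs_mult, (Rabs_pos_eq (2 * PI / INR n)) by (apply Rdiv_le_0_compat; lra).
  assert (0 < 2 * PI / INR n) by (apply Rdiv_lt_0_compat; lra).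
  split; [nra|].
  apply Rlt_le_trans with (2 * PI / INR n * INR n); [apply Rmult_lt_compat_l; lra|right; field; lra]. }
assert (E : (cis t ^ n)%C = RtoC 1).
{ rewrite cis_pow; unfold t.
  replace (INR n * _) with (2 * PI * INR l + - (2 * PI * INR k)) by (field; lra).
  rewrite cis_plus; generalize (cis_opp (2 * PI * INR k)); rewrite !cis_2PI.
  intros Q; rewrite Cmult_1_r in Q; rewrite Cmult_1_l; exact Q. }
generalize (geom_csum (cis t) n); rewrite E; intros Q.
replace (csum _ n) with (/ (cis t - 1) * ((cis t - 1) * csum (fun j => cis t ^ j) n))%C
  by (field; apply Cminus_eq_contra; auto).
rewrite Q; ring.
Qed.

(** * Cauchy's coefficient estimate and Weierstrass' theorem *)

(** Discrete form of Cauchy's integral: averaging [f] against the character of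
    exponent [-k] over the [n]-th roots of unity on the circle of radius [r] keeps
    the term [c k * r ^ k] and kills every other term of index below [n]. The
    remaining terms form a tail of an absolutely convergent series, which vanishes as
    [n] grows, while the average is bounded by [M]. *)
Lemma cauchy_estimate c rho f r M k : powser c rho f -> 0 < r < rho ->
  (forall z, Cmod z = r -> Cmod (f z) <= M) -> Cmod (c k) * r ^ k <= M.
Proof.
intros H Hr HM; apply le_epsilon; intros eps He.
pose proof (powser_abs c rho f r H ltac:(lra)) as E.
destruct (Series_tail_small _ eps (fun n => Rmult_le_pos _ _ (Cmod_ge_0 (c n)) (pow_le r n ltac:(lra))) E He)
  as [N HN].
set (n := S (N + k)); specialize (HN n ltac:(unfold n; lia)).
assert (Hn : 0 < INR n) by (apply lt_0_INR; unfold n; lia).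
set (zj := fun j => (RtoC r * cis (2 * PI * INR j / INR n))%C).
set (ej := fun j => cis (- (2 * PI * INR j * INR k / INR n))).
assert (Mz : forall j, Cmod (zj j) = r).
{ intros j; unfold zj; rewrite Cmod_mult, Cmod_cis, Cmod_R, Rabs_pos_eq; lra. }
set (A := fun l => (RtoC (/ INR n) * csum (fun j => cis (2 * PI * (INR l - INR k) / INR n) ^ j) n)%C).
set (avg := (RtoC (/ INR n) * csum (fun j => ej j * f (zj j)) n)%C).
assert (In : Rabs (/ INR n) = / INR n) by (apply Rabs_pos_eq; left; apply Rinv_0_lt_compat; auto).
assert (B1 : Cmod avg <= M).
{ unfold avg; rewrite Cmod_mult, Cmod_R, In.
  apply Rle_trans with (/ INR n * (INR n * M)).
  - apply Rmult_le_compat_l; [left; apply Rinv_0_lt_compat; auto|].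
    apply csum_le_const; intros j _; unfold ej; rewrite Cmod_mult, Cmod_cis, Rmult_1_l; auto.
  - right; field; lra. }
assert (HA : cseries (fun l => c l * RtoC r ^ l * A l)%C avg).
{ eapply cseries_ext; [|apply cseries_scal, (cseries_csum (fun j l => ej j * (c l * zj j ^ l))%C)].
  - intros l; unfold A; cbv beta.
    rewrite (csum_ext _ (fun j => (c l * RtoC r ^ l) * cis (2 * PI * (INR l - INR k) / INR n) ^ j)%C).
    + rewrite (csum_scal _ (fun j => cis (2 * PI * (INR l - INR k) / INR n) ^ j)%C); ring.
    + intros j _; unfold ej, zj; rewrite Cpow_mult_l, !cis_pow.
      replace (INR j * (2 * PI * (INR l - INR k) / INR n)) with
       (- (2 * PI * INR j * INR k / INR n) + INR l * (2 * PI * INR j / INR n)) by (field; lra).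
      rewrite cis_plus; ring.
  - intros j _; apply cseries_scal, H; rewrite Mz; lra. }
assert (HAk : csum (fun l => c l * RtoC r ^ l * A l)%C n = (c k * RtoC r ^ k)%C).
{ assert (Hkn : (k < n)%nat) by (unfold n; lia).
  rewrite (csum_one _ n k) by (auto; intros l Hl Hlk; unfold A; rewrite root_average by auto; ring).
  unfold A; rewrite (csum_ext _ (fun _ => RtoC 1 * RtoC 1)%C).
  - rewrite csum_scal.
    replace (csum (fun _ => RtoC 1) n) with (RtoC (INR n)).
    + rewrite RtoC_inv by lra; field; intros Q; apply RtoC_inj in Q; lra.
    + generalize n; intros p; induction p as [|p IH]; [reflexivity|].
      rewrite S_INR, RtoC_plus, IH; reflexivity.
  - intros j _; rewrite cis_pow.
    replace (INR j * _) with (2 * PI * INR 0) by (change (INR 0) with 0; field; apply Rgt_not_eq; exact Hn).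
    rewrite cis_2PI; ring. }
assert (B2 : Cmod (avg - c k * RtoC r ^ k) < eps).
{ rewrite <- HAk; eapply Rle_lt_trans; [|exact HN].
  apply (cseries_tail_le _ (fun l => Cmod (c l) * r ^ l)); auto.
  intros l; rewrite !Cmod_mult, Cmod_pow, Cmod_R, (Rabs_pos_eq r) by lra.
  rewrite <- (Rmult_1_r (Cmod (c l) * r ^ l)) at 2; apply Rmult_le_compat_l.
  { apply Rmult_le_pos; [apply Cmod_ge_0|apply pow_le; lra]. }
  unfold A; rewrite Cmod_mult, Cmod_R, In.
  apply Rle_trans with (/ INR n * (INR n * 1)); [|right; field; lra].
  apply Rmult_le_compat_l; [left; apply Rinv_0_lt_compat; auto|].
  apply csum_le_const; intros j _; rewrite Cmod_pow, Cmod_cis, pow1; lra. }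
replace (Cmod (c k) * r ^ k) with (Cmod (c k * RtoC r ^ k))
  by (rewrite Cmod_mult, Cmod_pow, Cmod_R, Rabs_pos_eq; lra).
replace (c k * RtoC r ^ k)%C with (avg + - (avg - c k * RtoC r ^ k))%C by ring.
eapply Rle_trans; [apply Cmod_triangle|]; rewrite Cmod_opp; lra.
Qed.

(** Bounds on circles become bounds on coefficients by [cauchy_estimate], so that the
    double series is dominated by [M m * (Cmod z / r) ^ k] and can be summed by columns.
    Products, reciprocals, and the analytic dependence of the L-function on its exponent
    are all obtained from this lemma. The description of the coefficients as column sums
    is what identifies the coefficients of a product. *)
Lemma weierstrass (c : nat -> nat -> C) rho (f : nat -> C -> C) F : 0 < rho ->
  (forall m, powser (c m) rho (f m)) ->
  (forall r, 0 < r < rho -> exists M : nat -> R, ex_series M /\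
     forall m z, Cmod z = r -> Cmod (f m z) <= M m) ->
  (forall z, Cmod z < rho -> cseries (fun m => f m z) (F z)) ->
  exists d, powser d rho F /\ forall k, cseries (fun m => c m k) (d k).
Proof.
intros HR Hc HM HF.
set (d := fun k => epsilon (inhabits (RtoC 0)) (fun l => cseries (fun m => c m k) l)).
assert (Hd : forall k, cseries (fun m => c m k) (d k)).
{ intros k; unfold d; apply epsilon_spec.
  destruct (HM (rho / 2) ltac:(lra)) as [M [EM HfM]].
  apply ex_cseries_le with (fun m => M m * / (rho / 2) ^ k).
  - intros m; pose proof (cauchy_estimate (c m) rho (f m) (rho / 2) (M m) k (Hc m) ltac:(lra) (HfM m)) as H.
    assert (0 < (rho / 2) ^ k) by (apply pow_lt; lra).
    apply Rmult_le_reg_r with ((rho / 2) ^ k); auto.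
    rewrite Rmult_assoc, Rinv_l by lra; lra.
  - apply (ex_series_scal_r _ M EM). }
exists d; split; auto; intros z Hz; pose proof (Cmod_ge_0 z) as Z0.
(* Any radius strictly between [Cmod z] and [rho] serves for the domination. *)
set (r := (Cmod z + rho) / 2); assert (Hr : Cmod z < r < rho) by (unfold r; lra).
destruct (HM r ltac:(lra)) as [M [EM HfM]].
apply (cseries_switch (fun m k => c m k * z ^ k)%C M (fun k => (Cmod z / r) ^ k) (fun m => f m z)); auto.
- intros m k; rewrite Cmod_mult, Cmod_pow, (Rdiv_pow_le (Cmod z) r), <- Rmult_assoc by lra.
  apply Rmult_le_compat_r; [apply pow_le, Rdiv_le_0_compat; lra|].
  apply (cauchy_estimate (c m) rho (f m)); auto; lra.
- intros m; eapply Rle_trans; [apply Cmod_ge_0|apply (HfM m (RtoC r))].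
  rewrite Cmod_R, Rabs_pos_eq; lra.
- intros k; apply pow_le, Rdiv_le_0_compat; lra.
- apply ex_series_geom; rewrite Rabs_pos_eq by (apply Rdiv_le_0_compat; lra).
  apply Rmult_lt_reg_r with r; [lra|]; unfold Rdiv; rewrite Rmult_assoc, Rinv_l; lra.
- intros m; apply (Hc m z Hz).
- intros k; eapply cseries_ext; [|eapply cseries_eq; [|exact (cseries_scal (z ^ k)%C _ _ (Hd k))]];
  [intros m|]; simpl; ring.
Qed.

(** * Products and reciprocals of power series *)

Lemma powser_ext_coef c d rho f : (forall k, c k = d k) -> powser c rho f -> powser d rho f.
Proof. intros E H z Hz; eapply cseries_ext; [|exact (H z Hz)]; intros k; simpl; rewrite E; ring. Qed.

Lemma powser_mulXn c rho f m : powser c rho f ->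
  powser (fun k => if (m <=? k)%nat then c (k - m)%nat else RtoC 0) rho (fun z => z ^ m * f z)%C.
Proof.
intros H; induction m as [|m IH].
- apply powser_ext_coef with c; [intros k; simpl; now rewrite Nat.sub_0_r|].
  apply powser_ext with f; auto; intros; simpl; ring.
- apply powser_mulX in IH; eapply powser_ext, powser_ext_coef; [| |exact IH].
  + intros z _; simpl; ring.
  + intros [|k]; reflexivity.
Qed.

(** The product is the sum over [m] of [c m * z ^ m * g z], whose terms have shifted
    copies of [d] as coefficients; [weierstrass] sums them. *)
Lemma powser_mult c d rho f g : 0 < rho -> powser c rho f -> powser d rho g ->
  powser (fun n => csum (fun i => c i * d (n - i)%nat) (S n))%C rho (fun z => f z * g z)%C.
Proof.
intros HR Hf Hg.
destruct (weierstrass (fun m k => c m * (if (m <=? k)%nat then d (k - m)%nat else RtoC 0))%C rho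
  (fun m z => c m * (z ^ m * g z))%C (fun z => f z * g z)%C) as (e & He & Hce); auto.
- intros m; apply powser_scal, powser_mulXn; auto.
- intros r Hr; destruct (powser_tail_bound d rho g r 0 Hg Hr) as [B [B0 HB]].
  exists (fun m => Cmod (c m) * r ^ m * B); split.
  + apply (ex_series_scal_r B (fun m => Cmod (c m) * r ^ m)).
    apply powser_abs with rho f; auto; lra.
  + intros m z Hz; specialize (HB z ltac:(lra)); simpl in HB.
    replace (g z - 0)%C with (g z) in HB by ring.
    rewrite !Cmod_mult, Cmod_pow, Hz, <- Rmult_assoc.
    apply Rmult_le_compat_l; [|lra].
    apply Rmult_le_pos; [apply Cmod_ge_0|apply pow_le; lra].
- intros z Hz; eapply cseries_ext; [|eapply cseries_eq; [|exact (cseries_scal (g z) _ _ (Hf z Hz))]];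
  [intros n|]; simpl; ring.
- apply powser_ext_coef with (2 := He); intros k.
  apply cseries_unique with (1 := Hce k).
  eapply cseries_eq; [|apply (cseries_finite _ (S k))].
  + apply csum_ext; intros i Hi; rewrite (proj2 (Nat.leb_le i k)) by lia; reflexivity.
  + intros i Hi; rewrite (proj2 (Nat.leb_gt i k)) by lia; ring.
Qed.

Lemma powser_pow c rho f n : 0 < rho -> powser c rho f -> exists d, powser d rho (fun z => f z ^ n)%C.
Proof.
intros HR H; induction n as [|n [d Hd]].
- eexists; exact (powser_const (RtoC 1) rho).
- eexists; simpl; apply powser_mult; eauto.
Qed.

Lemma cseries_geom x : Cmod x < 1 -> cseries (fun n => x ^ n)%C (/ (1 - x))%C.
Proof.
intros Hx.
assert (N : (1 - x)%C <> RtoC 0).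
{ apply Cminus_eq_contra; intros E; rewrite <- E, Cmod_1 in Hx; lra. }
pose proof (proj1 (Cmod_gt_0 _) N) as P.
apply cseries_eps; intros eps He.
destruct (pow_lt_1_zero (Cmod x) ltac:(rewrite Rabs_pos_eq; [auto|apply Cmod_ge_0]) (eps * Cmod (1 - x)))
  as [N0 HN0]; [apply Rmult_lt_0_compat; auto|].
exists N0; intros n Hn; specialize (HN0 n Hn).
rewrite Rabs_pos_eq in HN0 by (apply pow_le, Cmod_ge_0).
replace (csum _ n - _)%C with (- (x ^ n / (1 - x)))%C.
- rewrite Cmod_opp, Cmod_div, Cmod_pow by auto.
  apply Rmult_lt_reg_r with (Cmod (1 - x)); auto.
  unfold Rdiv; rewrite Rmult_assoc, Rinv_l; lra.
- replace (csum (fun n0 => x ^ n0)%C n) with (- ((x - 1) * csum (fun j => x ^ j) n) / (1 - x))%C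
   by (field; auto).
  rewrite geom_csum; field; auto.
Qed.

Lemma powser_at_0 c rho f : 0 < rho -> powser c rho f -> f (RtoC 0) = c 0%nat.
Proof.
intros HR H; specialize (H (RtoC 0) ltac:(rewrite Cmod_0; lra)).
apply cseries_unique with (1 := H).
eapply cseries_eq; [|apply (cseries_finite _ 1)].
- simpl; ring.
- intros [|k] Hk; [lia|simpl; ring].
Qed.

(** Near the centre [f] is [f 0 * (1 - w)] with [Cmod w <= 1 / 2], and the geometric
    series of [w] converges uniformly, so that [weierstrass] applies. *)
Lemma powser_inv c rho f : 0 < rho -> powser c rho f -> f (RtoC 0) <> RtoC 0 ->
  exists r e, 0 < r <= rho /\ (forall z, Cmod z < r -> f z <> RtoC 0) /\ powser e r (fun z => / f z)%C.
Proof.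
intros HR H Hc; pose proof (powser_at_0 c rho f HR H) as F0; set (c0 := f (RtoC 0)) in *.
pose proof (proj1 (Cmod_gt_0 _) Hc) as Pc.
destruct (powser_tail_bound c rho f (rho / 2) 1 H ltac:(lra)) as [B [B0 HB]].
set (r := Rmin (rho / 2) (Cmod c0 / (2 * (B + 1)))).
assert (Hr0 : 0 < Cmod c0 / (2 * (B + 1))) by (apply Rdiv_lt_0_compat; lra).
assert (Hr : 0 < r) by (apply Rmin_pos; lra).
pose proof (Rmin_l (rho / 2) (Cmod c0 / (2 * (B + 1)))) as L1.
pose proof (Rmin_r (rho / 2) (Cmod c0 / (2 * (B + 1)))) as L2.
fold r in L1, L2.
set (w := fun z => (1 - / c0 * f z)%C).
assert (Hw : powser (fun k => (match k with O => RtoC 1 | _ => RtoC 0 end) - / c0 * c k)%C rho w).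
{ apply powser_minus; [apply powser_const|apply powser_scal; auto]. }
assert (Bw : forall z, Cmod z < r -> Cmod (w z) <= 1 / 2).
{ intros z Hz; specialize (HB z ltac:(lra)).
  simpl in HB; rewrite Rmult_1_r in HB.
  replace (f z - (0 + c 0%nat * 1))%C with (- c0 * w z)%C in HB
    by (unfold w; rewrite <- F0; field; auto).
  rewrite Cmod_mult, Cmod_opp in HB.
  apply Rmult_le_reg_l with (Cmod c0); auto.
  apply Rle_trans with (1 := HB); apply Rle_trans with (r * (B + 1)).
  - apply Rmult_le_compat; try lra; apply Cmod_ge_0.
  - apply Rle_trans with (Cmod c0 / (2 * (B + 1)) * (B + 1)).
    + apply Rmult_le_compat_r; lra.
    + right; field; lra. }
assert (Nf : forall z, Cmod z < r -> f z <> RtoC 0).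
{ intros z Hz E; specialize (Bw z Hz); unfold w in Bw; rewrite E in Bw.
  replace (1 - / c0 * 0)%C with (RtoC 1) in Bw by ring; rewrite Cmod_1 in Bw; lra. }
destruct (choice (fun n d => powser d r (fun z => w z ^ n)%C)) as [p Hp].
{ intros n; destruct (powser_pow _ rho w n HR Hw) as [d Hd]; exists d.
  apply powser_sub with rho; auto; lra. }
destruct (weierstrass p r (fun n z => w z ^ n)%C (fun z => / (1 - w z))%C Hr Hp) as (e & He & _).
- intros r' Hr'; exists (fun n => (1 / 2) ^ n); split.
  + apply ex_series_geom; rewrite Rabs_pos_eq; lra.
  + intros m z Hz; rewrite Cmod_pow; apply pow_incr; split; [apply Cmod_ge_0|apply Bw; lra].
- intros z Hz; apply cseries_geom; specialize (Bw z Hz); lra.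
- exists r, (fun k => / c0 * e k)%C; split; [lra|]; split; auto.
  eapply powser_ext; [|apply powser_scal; exact He].
  intros z Hz; unfold w; simpl; field; split; auto.
Qed.

(** * Taylor's formula and the exponential series *)

(** A complex function of a real variable is differentiated through its real and
    imaginary parts, to which the mean value theorem applies. *)
Definition is_Cderive (g : R -> C) (t : R) (g' : C) : Prop :=
  is_derive (fun v => Re (g v)) t (Re g') /\ is_derive (fun v => Im (g v)) t (Im g').

Fixpoint rsum (f : nat -> R) (n : nat) : R :=
  match n with O => 0 | S m => rsum f m + f m end.

Lemma rsum_ext f g n : (forall k, f k = g k) -> rsum f n = rsum g n.
Proof. intros E; induction n as [|n IH]; simpl; [|rewrite IH, E]; reflexivity. Qed.

Lemma rsum_nonneg f n : (forall k, 0 <= f k) -> 0 <= rsum f n.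
Proof. intros H; induction n as [|n IH]; simpl; [lra|]. generalize (H n); lra. Qed.

Lemma rsum_le_term f n k : (forall i, 0 <= f i) -> (k < n)%nat -> f k <= rsum f n.
Proof.
intros Hf; induction n as [|n IH]; intros H; [lia|simpl].
destruct (Nat.eq_dec k n) as [->|]; [generalize (rsum_nonneg f n Hf); lra|].
generalize (IH ltac:(lia)) (Hf n); lra.
Qed.

Lemma Re_csum f n : Re (csum f n) = rsum (fun k => Re (f k)) n.
Proof. induction n as [|n IH]; simpl; [reflexivity|]. rewrite <- IH; reflexivity. Qed.

Lemma Im_csum f n : Im (csum f n) = rsum (fun k => Im (f k)) n.
Proof. induction n as [|n IH]; simpl; [reflexivity|]. rewrite <- IH; reflexivity. Qed.

Lemma derive_nonneg_le (h h' : R -> R) x y : x <= y ->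
  (forall v, x <= v <= y -> is_derive h v (h' v)) ->
  (forall v, x <= v <= y -> 0 <= h' v) -> h x <= h y.
Proof.
intros L D P; destruct (MVT_gen h x y h') as (c & Hc & E).
- intros v Hv; rewrite Rmin_left, Rmax_right in Hv by auto; apply D; lra.
- intros v Hv; rewrite Rmin_left, Rmax_right in Hv by auto.
  apply continuity_pt_filterlim, (ex_derive_continuous h); exists (h' v); apply D; lra.
- rewrite Rmin_left, Rmax_right in Hc by auto.
  specialize (P c Hc); nra.
Qed.

Lemma taylor_term_derive (a x v : R) n :
  is_derive (fun v => a * (v - x) ^ S n / INR (fact (S n))) v (a * (v - x) ^ n / INR (fact n)).
Proof.
assert (E : INR (fact (S n)) = INR (S n) * INR (fact n)) by (rewrite fact_simpl, mult_INR; auto).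
rewrite E; revert E; generalize (INR_fact_neq_0 n) (not_0_INR (S n) ltac:(lia)).
generalize (INR (fact n)) (INR (fact (S n))); intros f f' Hf Hn _.
auto_derive; [auto|].
change (match n with O => 1 | S _ => INR n + 1 end) with (INR (S n)).
replace (v + - x) with (v - x) by ring; field; auto.
Qed.

Lemma rsum_taylor_derive (a : nat -> R) (x v : R) n :
  is_derive (fun v => rsum (fun j => a j * (v - x) ^ j / INR (fact j)) (S n)) v
    (rsum (fun j => a (S j) * (v - x) ^ j / INR (fact j)) n).
Proof.
induction n as [|n IH].
- simpl; auto_derive; [auto|ring].
- change (rsum (fun j => a (S j) * (v - x) ^ j / INR (fact j)) (S n)) with
   (rsum (fun j => a (S j) * (v - x) ^ j / INR (fact j)) n + a (S n) * (v - x) ^ n / INR (fact n)).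
  apply (is_derive_plus (fun v => rsum (fun j => a j * (v - x) ^ j / INR (fact j)) (S n))
    (fun v => a (S n) * (v - x) ^ (S n) / INR (fact (S n))) v _ _ IH).
  apply taylor_term_derive.
Qed.

(** The sequence [g] stands for a function and its successive derivatives. In the
    induction the error for [g] has the error for the shifted sequence as derivative,
    and vanishes at [x]. *)
Lemma taylor_real n : forall (g : nat -> R -> R) x y M, x <= y ->
  (forall j v, (j < n)%nat -> x <= v <= y -> is_derive (g j) v (g (S j) v)) ->
  (forall v, x <= v <= y -> Rabs (g n v) <= M) ->
  Rabs (g 0%nat y - rsum (fun j => g j x * (y - x) ^ j / INR (fact j)) n) <= M * (y - x) ^ n / INR (fact n).
Proof.
induction n as [|n IH]; intros g x y M L D B.
- simpl; rewrite Rminus_0_r; unfold Rdiv; rewrite Rinv_1, !Rmult_1_r; apply B; lra.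
(* [e] is the error for [g], [e'] the error for its derivatives, and [h] the claimed bound. *)
- set (e := fun v => g 0%nat v - rsum (fun j => g j x * (v - x) ^ j / INR (fact j)) (S n)).
  set (e' := fun v => g 1%nat v - rsum (fun j => g (S j) x * (v - x) ^ j / INR (fact j)) n).
  set (h := fun v => M * (v - x) ^ S n / INR (fact (S n))).
  set (h' := fun v => M * (v - x) ^ n / INR (fact n)).
  assert (De : forall v, x <= v <= y -> is_derive e v (e' v)).
  { intros v Hv; apply (is_derive_minus (g 0%nat)); [apply D; auto with arith; lia|].
    apply (rsum_taylor_derive (fun j => g j x)). }
  assert (Dh : forall v, is_derive h v (h' v)).
  { intros v; apply taylor_term_derive. }
  assert (E : forall v, x <= v <= y -> Rabs (e' v) <= h' v).
  { intros v Hv; apply (IH (fun j => g (S j)) x v M); try lra.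
    - intros j u Hj Hu; apply D; [lia|lra].
    - intros u Hu; apply B; lra. }
  assert (Ex : e x = 0).
  { unfold e; rewrite Rminus_diag; clear.
    replace (rsum _ _) with (g 0%nat x); [ring|].
    induction n as [|n IH]; [simpl; field|].
    change (g 0%nat x = rsum (fun j => g j x * 0 ^ j / INR (fact j)) (S n) + g (S n) x * 0 ^ S n / INR (fact (S n))).
    rewrite <- IH, pow_i by lia; unfold Rdiv; ring. }
  assert (Hx : h x = 0) by (unfold h; rewrite Rminus_diag, pow_i by lia; unfold Rdiv; ring).
  fold (e y) (h y); apply Rabs_le; split.
  + assert (h x + e x <= h y + e y); [|lra].
    apply (derive_nonneg_le (fun v => h v + e v) (fun v => h' v + e' v)); auto.
    * intros v Hv; apply (is_derive_plus h e); auto.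
    * intros v Hv; specialize (E v Hv); apply Rabs_le_between in E; lra.
  + assert (h x - e x <= h y - e y); [|lra].
    apply (derive_nonneg_le (fun v => h v - e v) (fun v => h' v - e' v)); auto.
    * intros v Hv; apply (is_derive_minus h e); auto.
    * intros v Hv; specialize (E v Hv); apply Rabs_le_between in E; lra.
Qed.

Lemma Cmod_le_Re_Im z : Cmod z <= Rabs (Re z) + Rabs (Im z).
Proof.
replace z with (RtoC (Re z) + Ci * RtoC (Im z))%C at 1.
- eapply Rle_trans; [apply Cmod_triangle|].
  rewrite Cmod_mult, Cmod_Ci, !Cmod_R; lra.
- destruct z as [a b]; unfold Cplus, Cmult, Ci, RtoC, Re, Im; simpl; f_equal; ring.
Qed.

Lemma im_le_Cmod z : Rabs (Im z) <= Cmod z.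
Proof. eapply Rle_trans; [apply Rmax_r|apply (Rmax_Cmod z)]. Qed.

Lemma Re_minus a b : Re (a - b) = Re a - Re b.
Proof. reflexivity. Qed.

Lemma Im_minus a b : Im (a - b) = Im a - Im b.
Proof. reflexivity. Qed.

Lemma taylor_complex n (g : nat -> R -> C) x y M : x <= y ->
  (forall j v, (j < n)%nat -> x <= v <= y -> is_Cderive (g j) v (g (S j) v)) ->
  (forall v, x <= v <= y -> Cmod (g n v) <= M) ->
  Cmod (g 0%nat y - csum (fun j => g j x * RtoC ((y - x) ^ j / INR (fact j))) n)%C
    <= 2 * (M * (y - x) ^ n / INR (fact n)).
Proof.
intros L D B; eapply Rle_trans; [apply Cmod_le_Re_Im|].
rewrite <- Rplus_diag; apply Rplus_le_compat.
- eapply Rle_trans; [right; apply (f_equal Rabs)|apply (taylor_real n (fun j v => Re (g j v)) x y M L)].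
  + rewrite Re_minus.
    f_equal; rewrite Re_csum; apply rsum_ext; intros k; rewrite re_scal_r; unfold Rdiv; ring.
  + intros j v Hj Hv; apply (D j v Hj Hv).
  + intros v Hv; eapply Rle_trans; [apply re_le_Cmod|auto].
- eapply Rle_trans; [right; apply (f_equal Rabs)|apply (taylor_real n (fun j v => Im (g j v)) x y M L)].
  + rewrite Im_minus.
    f_equal; rewrite Im_csum; apply rsum_ext; intros k; rewrite im_scal_r; unfold Rdiv; ring.
  + intros j v Hj Hv; apply (D j v Hj Hv).
  + intros v Hv; eapply Rle_trans; [apply im_le_Cmod|auto].
Qed.

Lemma is_Cderive_Cexp (a b : C) (L : R -> R) (t l : R) : is_derive L t l ->
  is_Cderive (fun t => a * Cexp (b * RtoC (L t)))%C t (a * (b * RtoC l) * Cexp (b * RtoC (L t)))%C.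
Proof.
intros H; pose proof (is_derive_unique _ _ _ H) as U.
assert (X : ex_derive L t) by (exists l; auto).
destruct a as [a1 a2], b as [b1 b2]; split; unfold Cexp, Cmult, RtoC, Re, Im; simpl;
 auto_derive; try (repeat split; exact X); try exact I; change (fun x => L x) with L; rewrite U; rewrite <- ?Rminus_def; ring.
Qed.

(** Taylor's formula for [t => Cexp (z * t)] between [0] and [1], whose [n]-th
    derivative is bounded by [Cmod z ^ n * exp (Cmod z)]. *)
Lemma cseries_Cexp z : cseries (fun k => RtoC (/ INR (fact k)) * z ^ k)%C (Cexp z).
Proof.
apply cseries_eps; intros eps He.
pose proof (exp_pos (Cmod z)) as P.
destruct (cv_speed_pow_fact (Cmod z) (eps / (2 * exp (Cmod z)))) as [N HN].
{ apply Rdiv_lt_0_compat; lra. }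
exists N; intros n Hn; specialize (HN n Hn); unfold Rdist in HN; rewrite Rminus_0_r in HN.
set (X := Cmod z ^ n / INR (fact n)) in *.
assert (X0 : 0 <= X) by (apply Rdiv_le_0_compat; [apply pow_le, Cmod_ge_0|apply INR_fact_lt_0]).
rewrite Rabs_pos_eq in HN by auto.
pose proof (taylor_complex n (fun j t => z ^ j * Cexp (z * RtoC t))%C 0 1 (Cmod z ^ n * exp (Cmod z)) ltac:(lra)) as T.
simpl in T; rewrite Rminus_0_r, pow1 in T.
replace (csum _ n - Cexp z)%C with
 (- (1 * Cexp (z * 1) - csum (fun j => z ^ j * Cexp (z * 0) * RtoC (1 ^ j / INR (fact j))) n))%C.
- rewrite Cmod_opp; eapply Rle_lt_trans; [apply T|].
  + intros j v Hj Hv.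
    pose proof (is_Cderive_Cexp (z ^ j)%C z (fun t => t) v 1 (is_derive_id v)) as D.
    replace (z * z ^ j * Cexp (z * RtoC v))%C with (z ^ j * (z * 1) * Cexp (z * RtoC v))%C by ring; exact D.
  + intros v Hv; rewrite Cmod_mult, Cmod_pow, Cmod_Cexp; apply Rmult_le_compat_l; [apply pow_le, Cmod_ge_0|].
    assert (Q : Re (z * RtoC v) <= Cmod z).
    { eapply Rle_trans; [apply Rle_abs|]; eapply Rle_trans; [apply re_le_Cmod|].
      rewrite Cmod_mult, Cmod_R, Rabs_pos_eq by lra; generalize (Cmod_ge_0 z); nra. }
    destruct Q as [Q|Q]; [left; apply exp_increasing; auto|rewrite Q; lra].
  + replace (2 * _) with (X * (2 * exp (Cmod z))) by (unfold X; field; apply INR_fact_neq_0).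
    apply Rlt_le_trans with (eps / (2 * exp (Cmod z)) * (2 * exp (Cmod z))); [apply Rmult_lt_compat_r; lra|].
    right; field; lra.
- replace (z * 1)%C with z by ring; replace (z * 0)%C with (RtoC 0) by ring; rewrite Cexp_0.
  rewrite (csum_ext (fun j => z ^ j * 1 * RtoC (1 ^ j / INR (fact j)))%C (fun k => RtoC (/ INR (fact k)) * z ^ k)%C).
  + ring.
  + intros k _; rewrite pow1; unfold Rdiv; rewrite Rmult_1_l; ring.
Qed.

Lemma powser_Cexp a rho : powser (fun k => RtoC (/ INR (fact k)) * a ^ k)%C rho (fun z => Cexp (a * z)).
Proof.
intros z _; eapply cseries_ext; [|apply cseries_Cexp].
intros n; simpl; rewrite Cpow_mult_l; ring.
Qed.

(** * Complex powers of a positive real *)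

Lemma Rcpow_plus u a b : Rcpow u (a + b) = (Rcpow u a * Rcpow u b)%C.
Proof. unfold Rcpow; rewrite <- Cexp_plus; f_equal; ring. Qed.

Lemma Rcpow_opp u a : Rcpow u (- a) = (/ Rcpow u a)%C.
Proof. unfold Rcpow; rewrite <- Cexp_opp; f_equal; ring. Qed.

Lemma Rcpow_nat u n : 0 < u -> Rcpow u (RtoC (INR n)) = RtoC (u ^ n).
Proof.
intros Hu; unfold Rcpow; rewrite <- RtoC_mult, Cexp_RtoC; f_equal.
rewrite <- Rpower_pow by auto; reflexivity.
Qed.

Lemma Rcpow_1 u : 0 < u -> Rcpow u (RtoC 1) = RtoC u.
Proof. intros Hu; change 1 with (INR 1); rewrite Rcpow_nat by auto; f_equal; ring. Qed.

Lemma Cmod_Rcpow u w : Cmod (Rcpow u w) = Rpower u (Re w).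
Proof. unfold Rcpow; rewrite Cmod_Cexp, re_scal_r; reflexivity. Qed.

Lemma Rpower_decr u v e : 0 < u <= v -> e <= 0 -> Rpower v e <= Rpower u e.
Proof.
intros H He; unfold Rpower.
assert (L : ln u <= ln v) by (apply ln_le; lra).
assert (Q : e * ln v <= e * ln u) by nra.
destruct Q as [Q|Q]; [left; apply exp_increasing; auto|rewrite Q; lra].
Qed.

Lemma Rpower_pos u e : 0 < Rpower u e.
Proof. apply exp_pos. Qed.

(** Explicitly, [u ^ e < eps] as soon as [u > exp (ln eps / e)]. *)
Lemma Rpower_progression_small b h e eps : 0 < b -> 0 < h -> e < 0 -> 0 < eps ->
  exists N, forall m, (N <= m)%nat -> Rpower (b + h * INR m) e < eps.
Proof.
intros Hb Hh He Heps; set (y := exp (ln eps / e)).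
destruct (INR_archimed h y Hh) as [N HN]; exists N; intros m Hm.
apply le_INR in Hm.
assert (Y : y < b + h * INR m) by nra.
unfold Rpower; rewrite <- (exp_ln eps) by auto; apply exp_increasing.
assert (L : ln eps / e < ln (b + h * INR m)).
{ rewrite <- (ln_exp (ln eps / e)); apply ln_increasing; [apply exp_pos|exact Y]. }
replace (ln eps) with (e * (ln eps / e)) by (field; lra); nra.
Qed.

(** By the mean value theorem the terms are bounded by the increments of a multiple
    of the decreasing function [u => u ^ (e + 1)], and these telescope. *)
Lemma ex_series_Rpower_progression b h e : 0 < b -> 0 < h -> e < -1 ->
  ex_series (fun m => Rpower (b + h * INR m) e).
Proof.
intros Hb Hh He; apply ex_series_incr_1.
set (T := fun m => Rpower (b + h * INR m) (e + 1)).
set (k := (- e - 1) * h); assert (Hk : 0 < k) by (unfold k; nra).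
assert (S1 : forall m, Rpower (b + h * INR (S m)) e <= (T m - T (S m)) / k).
{ intros m; pose proof (pos_INR m) as Pm.
  set (u := b + h * INR m); set (v := b + h * INR (S m)).
  assert (Hu : 0 < u) by (unfold u; nra).
  assert (Hv : v = u + h) by (unfold u, v; rewrite S_INR; ring).
  destruct (MVT_cor2 (fun x => Rpower x (e + 1)) (fun x => (e + 1) * Rpower x (e + 1 - 1)) u v ltac:(lra))
    as (c & Hc & Hc'); [intros c Hc; apply derivable_pt_lim_power; lra|].
  replace (e + 1 - 1) with e in Hc by ring.
  apply Rmult_le_reg_r with k; auto; unfold Rdiv at 1; rewrite Rmult_assoc, Rinv_l, Rmult_1_r by lra.
  unfold T; fold u; fold v.
  replace (Rpower u (e + 1) - Rpower v (e + 1)) with (Rpower c e * k)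
    by (unfold k; rewrite Hv in Hc; replace (u + h - u) with h in Hc by ring; rewrite Hv; lra).
  apply Rmult_le_compat_r; [lra|apply Rpower_decr; lra]. }
destruct (ex_finite_lim_seq_incr (sum_n (fun m => Rpower (b + h * INR (S m)) e)) (T 0%nat / k)) as [l Hl].
- intros n; rewrite sum_Sn; generalize (Rpower_pos (b + h * INR (S (S n))) e).
  intros P; unfold plus; simpl in *; lra.
- intros n; apply Rle_trans with ((T 0%nat - T (S n)) / k).
  + induction n as [|n IH]; [rewrite sum_O; apply S1|].
    rewrite sum_Sn; unfold plus; simpl plus; eapply Rle_trans; [apply Rplus_le_compat; [exact IH|apply S1]|].
    right; field; lra.
  + apply Rmult_le_compat_r; [left; apply Rinv_0_lt_compat; auto|].
    generalize (Rpower_pos (b + h * INR (S n)) (e + 1)); unfold T at 2; lra.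
- exists l; exact Hl.
Qed.

Lemma cseries_telescope (d : nat -> C) :
  (forall eps, 0 < eps -> exists N, forall n, (N <= n)%nat -> Cmod (d n) < eps) ->
  cseries (fun m => d m - d (S m))%C (d 0%nat).
Proof.
intros H; apply cseries_eps; intros eps He; destruct (H eps He) as [N HN]; exists N; intros n Hn.
assert (E : csum (fun m => d m - d (S m))%C n = (d 0%nat - d n)%C).
{ clear; induction n as [|n IH]; simpl; [|rewrite IH]; ring. }
rewrite E; replace (d 0%nat - d n - d 0%nat)%C with (- d n)%C by ring; rewrite Cmod_opp; auto.
Qed.

Lemma csum_triangle (F : nat -> nat -> C) n :
  csum (fun j => csum (F j) (n - j)) n = csum (fun m => csum (fun i => F i (m - i)%nat) (S m)) n.
Proof.
induction n as [|n IH]; [reflexivity|].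
change (csum (fun m => csum (fun i => F i (m - i)%nat) (S m)) (S n)) with
 (csum (fun m => csum (fun i => F i (m - i)%nat) (S m)) n + csum (fun i => F i (n - i)%nat) (S n))%C.
change (csum (fun j => csum (F j) (S n - j)) (S n)) with
 (csum (fun j => csum (F j) (S n - j)) n + csum (F n) (S n - n))%C.
rewrite <- IH, (csum_ext (fun j => csum (F j) (S n - j)) (fun j => csum (F j) (n - j) + F j (n - j)%nat)%C).
- rewrite csum_plus; replace (S n - n)%nat with 1%nat by lia.
  simpl; rewrite Nat.sub_diag; ring.
- intros j Hj; rewrite Nat.sub_succ_l by lia; reflexivity.
Qed.

(** * Euler-Maclaurin summation of twisted power series *)

Fixpoint falling (w : C) (j : nat) : C :=
  match j with O => RtoC 1 | S i => (falling w i * (w - RtoC (INR i)))%C end.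

(** The [j]-th derivative of [u ^ w] with respect to [u]. *)
Definition pow_deriv (j : nat) (w : C) (u : R) : C := (falling w j * Rcpow u (w - RtoC (INR j)))%C.

Lemma pow_deriv_is_Cderive j w u : 0 < u -> is_Cderive (pow_deriv j w) u (pow_deriv (S j) w u).
Proof.
intros Hu.
pose proof (is_Cderive_Cexp (falling w j) (w - RtoC (INR j)) ln u (/ u)
  (proj2 (is_derive_Reals ln u (/ u)) (derivable_pt_lim_ln u Hu))) as H.
replace (pow_deriv (S j) w u) with
  (falling w j * ((w - RtoC (INR j)) * RtoC (/ u)) * Cexp ((w - RtoC (INR j)) * RtoC (ln u)))%C; [exact H|].
unfold pow_deriv; simpl falling; rewrite S_INR, RtoC_plus.
replace (w - (RtoC (INR j) + 1))%C with ((w - RtoC (INR j)) + - (1))%C by ring.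
rewrite Rcpow_plus, Rcpow_opp, Rcpow_1, RtoC_inv by lra.
unfold Rcpow; ring.
Qed.

Lemma falling_bound w j A : Cmod w <= A -> Cmod (falling w j) <= (A + INR j) ^ j.
Proof.
intros H; pose proof (Cmod_ge_0 w) as W; induction j as [|j IH]; simpl falling; [rewrite Cmod_1; simpl; lra|].
pose proof (pos_INR j).
rewrite Cmod_mult, <- tech_pow_Rmult, Rmult_comm; apply Rmult_le_compat; try apply Cmod_ge_0.
- unfold Cminus; eapply Rle_trans; [apply Cmod_triangle|].
  rewrite Cmod_opp, Cmod_R, Rabs_pos_eq by auto; rewrite S_INR; lra.
- eapply Rle_trans; [exact IH|]; apply pow_incr; rewrite S_INR; lra.
Qed.

Lemma falling_nat_zero n j : (n < j)%nat -> falling (RtoC (INR n)) j = RtoC 0.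
Proof.
induction j as [|j IH]; intros H; [lia|simpl].
destruct (Nat.eq_dec j n) as [->|]; [|rewrite IH by lia]; ring.
Qed.

Lemma falling_nat n j : (j <= n)%nat ->
  (falling (RtoC (INR n)) j = RtoC (INR (fact n)) / RtoC (INR (fact (n - j))))%C.
Proof.
induction j as [|j IH]; intros H.
- simpl; rewrite Nat.sub_0_r; field; intros E; apply RtoC_inj in E; revert E; apply INR_fact_neq_0.
- simpl; rewrite IH by lia.
  replace (n - j)%nat with (S (n - S j)) by lia.
  rewrite fact_simpl, mult_INR, RtoC_mult.
  replace (INR (S (n - S j))) with (INR n - INR j) by (rewrite <- minus_INR by lia; f_equal; lia).
  rewrite RtoC_minus; field; split; [intros E; apply RtoC_inj in E; revert E; apply INR_fact_neq_0|].
  rewrite <- RtoC_minus; intros E; apply RtoC_inj in E; apply lt_INR in H; lra.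
Qed.

Section EulerMaclaurin.

Variables (mu : C) (h b : R) (P : nat -> C).
Hypothesis Hmu : Cmod mu = 1.
Hypothesis Hh : 0 < h.
Hypothesis Hb : 0 < b.
Hypothesis HP : forall j,
  (P j - mu * csum (fun i => P i * RtoC (h ^ (j - i) / INR (fact (j - i)))) (S j) =
   if Nat.eqb j 1 then 1 else 0)%C.

(** [P] is the coefficient sequence of [t / (1 - mu * exp (h * t))]; the hypothesis
    [HP] is that identity multiplied out. Writing [D] for [d / du], [em_sum] is the
    operator [D / (1 - mu * exp (h * D))] applied to [u ^ w] and truncated at order
    [N]. Since [exp (h * D)] is the translation by [h], its twisted difference
    [em_sum u - mu * em_sum (u + h)] is the derivative of [u ^ w] up to the
    truncation error [em_rem]. *)
Definition em_sum (N : nat) (w : C) (u : R) : C := csum (fun j => P j * pow_deriv j w u)%C (S N).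
Definition em_rem (N : nat) (w : C) (u : R) : C :=
  (em_sum N w u - mu * em_sum N w (u + h) - pow_deriv 1 w u)%C.

Definition node (m : nat) : R := b + h * INR m.

Lemma node_S m : node (S m) = node m + h.
Proof. unfold node; rewrite S_INR; ring. Qed.

Lemma node_ge m : b <= node m.
Proof. unfold node; generalize (pos_INR m); nra. Qed.

Lemma Cmod_mu_pow m : Cmod (mu ^ m) = 1.
Proof. rewrite Cmod_pow, Hmu, pow1; reflexivity. Qed.

(** Expanding [em_sum (u + h)] at [u] by Taylor's formula up to order [N], the
    recurrence on [P] cancels all terms except the Taylor remainders, which involve
    only the derivative of order [S N]. The bound thus gains [N + 1] powers of [u],
    and it vanishes when [u ^ w] is a polynomial of degree at most [N]. *)
Lemma em_rem_bound N : (1 <= N)%nat -> exists K, 0 <= K /\ forall w u, 0 < u -> Re w <= INR (S N) ->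
  Cmod (em_rem N w u) <= K * (Cmod (falling w (S N)) * Rpower u (Re w - INR (S N))).
Proof.
intros HN; remember (S N) as n eqn:En.
set (t := fun l => h ^ l / INR (fact l)).
assert (t0 : forall l, 0 <= t l).
{ intros l; apply Rdiv_le_0_compat; [apply pow_le; lra|apply INR_fact_lt_0]. }
exists (rsum (fun j => Cmod (P j) * (2 * t (n - j)%nat)) n); split.
{ apply rsum_nonneg; intros k; apply Rmult_le_pos; [apply Cmod_ge_0|].
  generalize (t0 (n - k)%nat); lra. }
intros w u Hu Hw; set (M := Cmod (falling w n) * Rpower u (Re w - INR n)).
(* Taylor remainder, of order [n - j], of the [j]-th derivative. *)
set (r := fun j => (pow_deriv j w (u + h) - csum (fun l => pow_deriv (j + l) w u * RtoC (t l)) (n - j))%C).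
assert (Br : forall j, (j < n)%nat -> Cmod (r j) <= 2 * t (n - j)%nat * M).
{ intros j Hj; unfold r.
  pose proof (taylor_complex (n - j) (fun l => pow_deriv (j + l) w) u (u + h) M ltac:(lra)) as T.
  cbv beta in T; rewrite Nat.add_0_r in T; replace (u + h - u) with h in T by ring.
  eapply Rle_trans; [apply T|right; unfold t; field; apply INR_fact_neq_0].
  - intros l v Hl Hv; rewrite Nat.add_succ_r; apply pow_deriv_is_Cderive; lra.
  - intros v Hv; replace (j + (n - j))%nat with n by lia.
    unfold pow_deriv, M; rewrite Cmod_mult, Cmod_Rcpow; apply Rmult_le_compat_l; [apply Cmod_ge_0|].
    change (Re (w - RtoC (INR n))) with (Re w - INR n).
    apply Rpower_decr; lra. }
assert (E : em_rem N w u = (- mu * csum (fun j => P j * r j) n)%C).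
{ unfold em_rem, em_sum; rewrite <- En.
  rewrite (csum_ext (fun j => P j * pow_deriv j w (u + h))%C
    (fun j => P j * r j + csum (fun l => P j * (pow_deriv (j + l) w u * RtoC (t l))) (n - j))%C)
    by (intros j Hj; rewrite csum_scal; unfold r; ring).
  rewrite csum_plus, (csum_triangle (fun j l => P j * (pow_deriv (j + l) w u * RtoC (t l)))%C).
  (* The recurrence on [P] leaves only the term of index [1]. *)
  assert (Z : pow_deriv 1 w u = csum (fun m => P m * pow_deriv m w u + - mu *
     csum (fun i => P i * (pow_deriv (i + (m - i)) w u * RtoC (t (m - i)%nat))) (S m))%C n).
  { rewrite (csum_ext _ (fun m => pow_deriv m w u * (if Nat.eqb m 1 then RtoC 1 else RtoC 0))%C).
    - rewrite (csum_one _ n 1); [simpl; ring|lia|].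
      intros k Hk Hk1; rewrite (proj2 (Nat.eqb_neq k 1)) by auto; ring.
    - intros m Hm; rewrite <- HP; fold t.
      rewrite (csum_ext _ (fun i => pow_deriv m w u * (P i * RtoC (t (m - i)%nat)))%C (S m)).
      + rewrite csum_scal; unfold t; ring.
      + intros i Hi; replace (i + (m - i))%nat with m by lia; ring. }
  rewrite Z, csum_plus, csum_scal; ring. }
rewrite E, Cmod_mult, Cmod_opp, Hmu, Rmult_1_l.
assert (G : forall k, (k <= n)%nat -> Cmod (csum (fun j => P j * r j)%C k) <=
  rsum (fun j => Cmod (P j) * (2 * t (n - j)%nat)) k * M).
{ induction k as [|k IH]; intros Hk; simpl; [rewrite Cmod_0; lra|].
  eapply Rle_trans; [apply Cmod_triangle|]; rewrite Rmult_plus_distr_r.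
  apply Rplus_le_compat; [apply IH; lia|].
  rewrite Cmod_mult, Rmult_assoc; apply Rmult_le_compat_l; [apply Cmod_ge_0|]; apply Br; lia. }
apply G; auto.
Qed.

Lemma em_rem_S N w u : em_rem (S N) w u =
  (em_rem N w u + P (S N) * (pow_deriv (S N) w u - mu * pow_deriv (S N) w (u + h)))%C.
Proof. unfold em_rem, em_sum; simpl csum; ring. Qed.

Lemma pow_deriv_small j w eps : Re w < INR j -> 0 < eps ->
  exists N, forall m, (N <= m)%nat -> Cmod (mu ^ m * pow_deriv j w (node m)) < eps.
Proof.
intros Hw He; pose proof (Cmod_ge_0 (falling w j)) as F.
destruct (Rpower_progression_small b h (Re w - INR j) (eps / (Cmod (falling w j) + 1)) Hb Hh) as [N HN];
  [lra|apply Rdiv_lt_0_compat; lra|].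
exists N; intros m Hm; specialize (HN m Hm); fold (node m) in HN.
rewrite Cmod_mult, Cmod_mu_pow, Rmult_1_l; unfold pow_deriv; rewrite Cmod_mult, Cmod_Rcpow.
change (Re (w - RtoC (INR j))) with (Re w - INR j).
pose proof (Rpower_pos (node m) (Re w - INR j)).
apply Rle_lt_trans with ((Cmod (falling w j) + 1) * Rpower (node m) (Re w - INR j)); [nra|].
apply Rlt_le_trans with ((Cmod (falling w j) + 1) * (eps / (Cmod (falling w j) + 1))).
- apply Rmult_lt_compat_l; lra.
- right; field; lra.
Qed.

(** [l] is the regularised sum of the series [mu ^ m * pow_deriv 1 w (node m)]: the
    telescoping part of its terms contributes [em_sum N w b], and the errors
    [em_rem] are summable when [Re w < N]. *)
Definition is_em_value (N : nat) (w l : C) : Prop :=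
  cseries (fun m => mu ^ m * em_rem N w (node m))%C (em_sum N w b - l)%C.

Lemma node_0 : node 0 = b.
Proof. unfold node; simpl; ring. Qed.

(** Passing from [N] to [S N] changes the errors by a telescoping series whose sum
    is exactly the new term of [em_sum] at [b]. *)
Lemma is_em_value_S N w l : Re w < INR (S N) -> is_em_value N w l -> is_em_value (S N) w l.
Proof.
intros Hw H; unfold is_em_value in *.
pose proof (cseries_telescope _ (fun eps He => pow_deriv_small (S N) w eps Hw He)) as T.
eapply cseries_ext; [|eapply cseries_eq; [|exact (cseries_plus _ _ _ _ H (cseries_scal (P (S N)) _ _ T))]].
- intros m; cbv beta; rewrite em_rem_S, node_S; simpl Cpow; ring.
- cbv beta; rewrite node_0; unfold em_sum; simpl; ring.
Qed.

Lemma is_em_value_le N N' w l : (N <= N')%nat -> Re w < INR (S N) ->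
  is_em_value N w l -> is_em_value N' w l.
Proof.
intros L Hw H; induction L as [|N' L IH]; auto.
apply is_em_value_S; auto; apply Rlt_le_trans with (1 := Hw); apply le_INR; lia.
Qed.

Lemma ex_em_value N w : (1 <= N)%nat -> Re w < INR N -> exists l, is_em_value N w l.
Proof.
intros HN Hw; destruct (em_rem_bound N HN) as (K & K0 & HK).
destruct (ex_cseries_le (fun m => mu ^ m * em_rem N w (node m))%C
  (fun m => K * (Cmod (falling w (S N)) * Rpower (b + h * INR m) (Re w - INR (S N))))) as [l Hl].
- intros m; rewrite Cmod_mult, Cmod_mu_pow, Rmult_1_l; apply HK.
  + apply Rlt_le_trans with b; [exact Hb|apply node_ge].
  + rewrite S_INR; lra.
- apply ex_rseries_scal, ex_rseries_scal.
  apply ex_series_Rpower_progression; auto; rewrite S_INR; lra.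
- exists (em_sum N w b - l)%C; unfold is_em_value; eapply cseries_eq; [|exact Hl]; ring.
Qed.

Definition em_value (w : C) : C :=
  epsilon (inhabits (RtoC 0)) (fun l => forall N, (1 <= N)%nat -> Re w < INR N -> is_em_value N w l).

Lemma em_value_spec N w : (1 <= N)%nat -> Re w < INR N -> is_em_value N w (em_value w).
Proof.
revert N; unfold em_value; apply epsilon_spec.
destruct (INR_unbounded (Re w)) as [N0 HN0].
assert (Hw0 : Re w < INR (S N0)) by (rewrite S_INR; lra).
destruct (ex_em_value (S N0) w ltac:(lia) Hw0) as [l Hl]; exists l.
intros N HN Hw; destruct (ex_em_value N w HN Hw) as [l' Hl'].
assert (E : l = l'); [|rewrite E; auto].
(* Values obtained at two orders are compared at a common larger order. *)
set (M := (N + S N0)%nat).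
assert (A : is_em_value M w l) by (apply is_em_value_le with (S N0); auto; [unfold M; lia|rewrite S_INR; lra]).
assert (B : is_em_value M w l') by (apply is_em_value_le with N; auto; [unfold M; lia|rewrite S_INR; lra]).
pose proof (cseries_unique _ _ _ A B) as U.
transitivity (em_sum M w b - (em_sum M w b - l))%C; [ring|rewrite U; ring].
Qed.

(** For [Re w < 0] all terms of [em_sum] tend to [0] along the nodes, so that the
    regularisation is an ordinary sum. *)
Lemma em_value_series w : Re w < 0 ->
  cseries (fun m => mu ^ m * pow_deriv 1 w (node m))%C (em_value w).
Proof.
intros Hw; pose proof (em_value_spec 1 w ltac:(lia) ltac:(simpl; lra)) as H; unfold is_em_value in H.
pose proof (cseries_telescope _ (fun eps He => pow_deriv_small 0 w eps Hw He)) as T0.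
pose proof (cseries_telescope _ (fun eps He => pow_deriv_small 1 w eps ltac:(simpl; lra) He)) as T1.
pose proof (cseries_plus _ _ _ _ (cseries_scal (P 0%nat) _ _ T0)
 (cseries_plus _ _ _ _ (cseries_scal (P 1%nat) _ _ T1) (cseries_scal (-(1))%C _ _ H))) as X.
eapply cseries_ext; [|eapply cseries_eq; [|exact X]].
- intros m; cbv beta; unfold em_rem, em_sum; rewrite node_S; simpl; ring.
- cbv beta; rewrite node_0; unfold em_sum; simpl; ring.
Qed.

(** At [w = n] the errors of order [N > n] vanish identically because [u ^ n] is a
    polynomial, and the regularised sum is [em_sum] at [b]. This is [n!] times the
    coefficient of [t ^ n] in [t * exp (b * t) / (1 - mu * exp (h * t))]. *)
Lemma em_value_nat n : em_value (RtoC (INR n)) =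
  (RtoC (INR (fact n)) * csum (fun j => P j * RtoC (b ^ (n - j) / INR (fact (n - j)))) (S n))%C.
Proof.
pose proof (em_value_spec (S n) (RtoC (INR n)) ltac:(lia) ltac:(rewrite re_RtoC, S_INR; lra)) as H.
unfold is_em_value in H.
destruct (em_rem_bound (S n) ltac:(lia)) as (K & K0 & HK).
assert (Z : forall m, (mu ^ m * em_rem (S n) (RtoC (INR n)) (node m))%C = RtoC 0).
{ intros m; apply Cmod_eq_0, Rle_antisym; [|apply Cmod_ge_0].
  rewrite Cmod_mult, Cmod_mu_pow, Rmult_1_l; eapply Rle_trans; [apply HK|].
  - apply Rlt_le_trans with b; [exact Hb|apply node_ge].
  - rewrite re_RtoC; apply le_INR; lia.
  - rewrite falling_nat_zero, Cmod_0 by lia; lra. }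
pose proof (cseries_unique _ _ _ H (cseries_finite _ 0 (fun k _ => Z k))) as U; simpl csum in U.
transitivity (em_sum (S n) (RtoC (INR n)) b).
{ transitivity (em_sum (S n) (RtoC (INR n)) b - (em_sum (S n) (RtoC (INR n)) b - em_value (RtoC (INR n))))%C;
  [ring|rewrite U; ring]. }
unfold em_sum.
change (csum (fun j => P j * pow_deriv j (RtoC (INR n)) b)%C (S n) + P (S n) * pow_deriv (S n) (RtoC (INR n)) b =
 RtoC (INR (fact n)) * csum (fun j => P j * RtoC (b ^ (n - j) / INR (fact (n - j)))) (S n))%C.
unfold pow_deriv at 2; rewrite falling_nat_zero by lia; rewrite <- csum_scal.
rewrite (csum_ext _ (fun k => RtoC (INR (fact n)) * (P k * RtoC (b ^ (n - k) / INR (fact (n - k)))))%C); [ring|].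
intros j Hj; unfold pow_deriv; rewrite falling_nat by lia.
rewrite <- RtoC_minus, <- minus_INR, Rcpow_nat by (auto; lia).
pose proof (INR_fact_neq_0 (n - j)) as F.
rewrite RtoC_div by auto; field; intros E; apply RtoC_inj in E; auto.
Qed.

End EulerMaclaurin.

(** * Analytic dependence on the exponent *)

Definition expandable (rho : R) (f : C -> C) : Prop := exists c, powser c rho f.

Lemma expandable_ext rho f g : (forall z, Cmod z < rho -> f z = g z) -> expandable rho f -> expandable rho g.
Proof. intros E [c H]; exists c; apply powser_ext with f; auto. Qed.

Lemma expandable_const rho a : expandable rho (fun _ => a).
Proof. eexists; apply powser_const. Qed.

Lemma expandable_id rho : expandable rho (fun z => z).
Proof. eexists; apply powser_id. Qed.

Lemma expandable_plus rho f g : expandable rho f -> expandable rho g -> expandable rho (fun z => f z + g z)%C.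
Proof. intros [c Hc] [d Hd]; eexists; apply powser_plus; eauto. Qed.

Lemma expandable_minus rho f g : expandable rho f -> expandable rho g -> expandable rho (fun z => f z - g z)%C.
Proof. intros [c Hc] [d Hd]; eexists; apply powser_minus; eauto. Qed.

Lemma expandable_mult rho f g : 0 < rho -> expandable rho f -> expandable rho g -> expandable rho (fun z => f z * g z)%C.
Proof. intros H [c Hc] [d Hd]; eexists; apply powser_mult; eauto. Qed.

Lemma expandable_csum rho (f : nat -> C -> C) n : (forall i, (i < n)%nat -> expandable rho (f i)) ->
  expandable rho (fun z => csum (fun i => f i z) n).
Proof.
induction n as [|n IH]; intros H; [exact (expandable_const rho (RtoC 0))|].
simpl; apply expandable_plus; auto.
Qed.

Lemma expandable_Cexp rho a : expandable rho (fun z => Cexp (a * z)).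
Proof. eexists; apply powser_Cexp. Qed.

Lemma expandable_falling rho w j : 0 < rho -> expandable rho (fun z => falling (w - z) j).
Proof.
intros HR; induction j as [|j IH]; [exact (expandable_const rho (RtoC 1))|].
simpl; apply expandable_mult; auto.
apply (expandable_minus rho (fun z => w - z)%C); [|apply expandable_const].
apply (expandable_minus rho (fun _ => w)); [apply expandable_const|apply expandable_id].
Qed.

Lemma expandable_pow_deriv rho j w u : 0 < rho -> expandable rho (fun z => pow_deriv j (w - z) u).
Proof.
intros HR; unfold pow_deriv; apply expandable_mult; auto; [now apply expandable_falling|].
apply expandable_ext with (fun z => Rcpow u (w - RtoC (INR j)) * Cexp (- RtoC (ln u) * z))%C.
- intros z _; unfold Rcpow; rewrite <- Cexp_plus; f_equal; ring.
- apply expandable_mult; auto using expandable_const, expandable_Cexp.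
Qed.

Lemma expandable_em_sum rho P N w u : 0 < rho -> expandable rho (fun z => em_sum P N (w - z) u).
Proof.
intros HR; apply (expandable_csum rho (fun j z => P j * pow_deriv j (w - z) u)%C); intros i _.
apply expandable_mult; auto using expandable_const, expandable_pow_deriv.
Qed.

Lemma expandable_em_rem rho mu h P N w u : 0 < rho -> expandable rho (fun z => em_rem mu h P N (w - z) u).
Proof.
intros HR; unfold em_rem.
apply (expandable_minus rho (fun z => em_sum P N (w - z) u - mu * em_sum P N (w - z) (u + h))%C).
- apply (expandable_minus rho (fun z => em_sum P N (w - z) u)); [now apply expandable_em_sum|].
  apply (expandable_mult rho (fun _ => mu)); auto using expandable_const, expandable_em_sum.
- now apply expandable_pow_deriv.
Qed.

Lemma Rpower_abs_bound b e A : Rabs e <= A -> Rpower b e <= exp (A * Rabs (ln b)).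
Proof.
intros H; unfold Rpower.
assert (Q : e * ln b <= A * Rabs (ln b)).
{ eapply Rle_trans; [apply Rle_abs|]; rewrite Rabs_mult.
  apply Rmult_le_compat_r; auto; apply Rabs_pos. }
destruct Q as [Q|Q]; [left; apply exp_increasing; auto|rewrite Q; lra].
Qed.

(** For a fixed disc a single order [N] is admissible, and each error [em_rem] is an
    explicit entire function of the exponent. The bound [em_rem_bound] is uniform on
    circles once the nodes are rescaled to be at least [1], which makes powers
    monotone in the exponent. *)
Lemma expandable_em_value mu h b P w rho : Cmod mu = 1 -> 0 < h -> 0 < b ->
  (forall j, (P j - mu * csum (fun i => P i * RtoC (h ^ (j - i) / INR (fact (j - i)))) (S j) =
     if Nat.eqb j 1 then 1 else 0)%C) ->
  0 < rho -> expandable rho (fun z => em_value mu h b P (w - z)).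
Proof.
intros Hmu Hh Hb HP HR.
destruct (INR_unbounded (Re w + rho)) as [N0 HN0].
set (N := S N0); assert (HN : (1 <= N)%nat) by (unfold N; lia).
assert (HwN : Re w + rho < INR N) by (unfold N; rewrite S_INR; lra).
clearbody N; clear N0 HN0.
assert (Hz : forall z, Cmod z < rho -> Re (w - z) <= Re w + Cmod z).
{ intros z Hz; rewrite Re_minus; generalize (re_le_Cmod z); intros Q.
  apply Rabs_le_between in Q; lra. }
set (remainder := fun z => (em_sum P N (w - z) b - em_value mu h b P (w - z))%C).
assert (HS : forall z, Cmod z < rho -> cseries (fun m => mu ^ m * em_rem mu h P N (w - z) (node h b m))%C (remainder z)).
{ intros z Hz1; apply (em_value_spec mu h b P Hmu Hh Hb HP N); auto.
  specialize (Hz z Hz1); lra. }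
assert (X : expandable rho remainder).
{ destruct (choice (fun m c => powser c rho (fun z => mu ^ m * em_rem mu h P N (w - z) (node h b m))%C)) as [c Hc].
  { intros m; apply expandable_mult; auto using expandable_const, expandable_em_rem. }
  destruct (weierstrass c rho _ remainder HR Hc) as (d & Hd & _); auto; [|exists d; auto].
  intros r Hr; destruct (em_rem_bound mu h P Hmu Hh HP N HN) as (K & K0 & HK).
  set (A := (Cmod w + r + INR (S N)) ^ S N).
  set (B := exp ((Cmod w + r + INR (S N)) * Rabs (ln b))).
  exists (fun m => K * (A * (B * Rpower (1 + h / b * INR m) (Re w + r - INR (S N))))).
  split.
  { repeat apply ex_rseries_scal; apply ex_series_Rpower_progression; [lra|apply Rdiv_lt_0_compat; lra|].
    rewrite S_INR; lra. }
  intros m z Hzr.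
  pose proof (node_ge h b Hh m) as Hnode.
  pose proof (Hz z ltac:(lra)) as Hwz.
  assert (Cw : Cmod (w - z) <= Cmod w + r).
  { unfold Cminus; eapply Rle_trans; [apply Cmod_triangle|]; rewrite Cmod_opp; lra. }
  assert (Hn : 0 < node h b m) by lra.
  rewrite Cmod_mult, Cmod_mu_pow, Rmult_1_l by auto.
  eapply Rle_trans; [apply HK; auto; rewrite S_INR; lra|].
  apply Rmult_le_compat_l; auto.
  apply Rmult_le_compat; [apply Cmod_ge_0|left; apply Rpower_pos|apply falling_bound; auto|].
  assert (En : node h b m = b * (1 + h / b * INR m)) by (unfold node; field; lra).
  assert (Hm : 1 <= 1 + h / b * INR m).
  { generalize (pos_INR m) (Rdiv_lt_0_compat h b Hh Hb); nra. }
  rewrite En, <- Rpower_mult_distr by lra.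
  apply Rmult_le_compat; try (left; apply Rpower_pos).
  - apply Rpower_abs_bound; eapply Rle_trans; [apply Rabs_triang|].
    rewrite Rabs_Ropp, (Rabs_pos_eq (INR _)) by apply pos_INR.
    generalize (re_le_Cmod (w - z)); lra.
  - destruct Hm as [Hm|Hm]; [apply Rle_Rpower; lra|].
    rewrite <- Hm; unfold Rpower; rewrite ln_1, !Rmult_0_r; lra. }
apply expandable_ext with (fun z => em_sum P N (w - z) b - remainder z)%C.
- intros z _; unfold remainder; ring.
- apply expandable_minus; auto using expandable_em_sum.
Qed.

(** * The generating function of the Apostol-Bernoulli numbers *)

Lemma RtoC_neq x : x <> 0 -> RtoC x <> RtoC 0.
Proof. intros H E; apply H, RtoC_inj, E. Qed.

Lemma powser_div_X c rho f : powser c rho f -> c 0%nat = RtoC 0 ->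
  exists g, powser (fun k => c (S k)) rho g /\ forall z, Cmod z < rho -> f z = (z * g z)%C.
Proof.
intros H H0.
set (g := fun z => if excluded_middle_informative (z = RtoC 0) then c 1%nat else (f z / z)%C).
exists g; split.
- intros z Hz; unfold g; destruct (excluded_middle_informative (z = RtoC 0)) as [E|E].
  + rewrite E; eapply cseries_eq; [|apply (cseries_finite _ 1)]; [simpl; ring|].
    intros [|k] Hk; [lia|simpl; ring].
  + apply cseries_eps; intros eps He.
    destruct (proj1 (cseries_eps _ _) (cseries_scal (/ z)%C _ _ (H z Hz)) eps He) as [N HN].
    exists N; intros n Hn; specialize (HN (S n) ltac:(lia)); rewrite csum_S_head in HN.
    eapply Rle_lt_trans; [right; apply (f_equal Cmod)|exact HN].
    rewrite H0, (csum_ext (fun k => / z * (c (S k) * z ^ S k))%C (fun k => c (S k) * z ^ k)%C)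
      by (intros k _; simpl; field; auto).
    unfold Cdiv; ring.
- intros z Hz; unfold g; destruct (excluded_middle_informative (z = RtoC 0)) as [E|E].
  + rewrite E in *; rewrite (powser_at_0 c rho f); auto; [rewrite H0; ring|].
    rewrite Cmod_0 in Hz; auto.
  + field; auto.
Qed.

(** When [mu] is not [1] the denominator is invertible at [0]; when [mu = 1] it has
    a simple zero there, which the numerator [t] cancels. *)
Lemma bernoulli_kernel (mu : C) (h : R) : 0 < h -> exists P r G, 0 < r /\ powser P r G /\
  (forall t, Cmod t < r -> G t * (1 - mu * Cexp (RtoC h * t)) = t)%C /\
  (forall t, t <> RtoC 0 -> Cmod t < r -> (1 - mu * Cexp (RtoC h * t))%C <> RtoC 0).
Proof.
intros Hh.
set (D := fun t => (1 - mu * Cexp (RtoC h * t))%C).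
assert (HD : exists d, powser d 1 D /\ d 0%nat = (1 - mu)%C /\ d 1%nat = (- mu * RtoC h)%C).
{ eexists; split; [exact (powser_minus _ _ 1 _ _ (powser_const (RtoC 1) 1)
    (powser_scal mu _ _ _ (powser_Cexp (RtoC h) 1)))|].
  simpl; rewrite Rinv_1; split; ring. }
destruct HD as (d & HD & d0 & d1).
assert (E0 : Cexp (RtoC h * RtoC 0) = RtoC 1) by (rewrite Cmult_0_r; apply Cexp_0).
destruct (excluded_middle_informative (mu = RtoC 1)) as [Emu|Nmu].
- destruct (powser_div_X _ _ _ HD) as (g & Hg & Eg).
  { rewrite d0, Emu; ring. }
  assert (g0 : g (RtoC 0) <> RtoC 0).
  { rewrite (powser_at_0 _ 1 g Rlt_0_1 Hg), d1, Emu.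
    replace (- (1) * RtoC h)%C with (- RtoC h)%C by ring.
    rewrite <- RtoC_opp; apply RtoC_neq; lra. }
  destruct (powser_inv _ 1 g Rlt_0_1 Hg g0) as (r & e & Hr & Ng & He).
  exists e, r, (fun z => / g z)%C; split; [lra|]; split; auto; split.
  + intros t Ht; fold (D t); rewrite Eg by lra; field; auto.
  + intros t t0 Ht; fold (D t); rewrite Eg by lra; apply Cmult_neq_0; auto.
- assert (D0 : D (RtoC 0) <> RtoC 0).
  { unfold D; rewrite E0, Cmult_1_r; apply Cminus_eq_contra; auto. }
  destruct (powser_inv _ 1 D Rlt_0_1 HD D0) as (r & e & Hr & Ng & He).
  eexists; exists r, (fun z => z * / D z)%C; split; [lra|]; split; [apply powser_mulX, He|]; split.
  + intros t Ht; fold (D t); field; auto.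
  + intros t t0 Ht; fold (D t); auto.
Qed.

Lemma kernel_recurrence mu h P r G : 0 < r -> powser P r G ->
  (forall t, Cmod t < r -> G t * (1 - mu * Cexp (RtoC h * t)) = t)%C ->
  forall j, (P j - mu * csum (fun i => P i * RtoC (h ^ (j - i) / INR (fact (j - i)))) (S j) =
     if Nat.eqb j 1 then 1 else 0)%C.
Proof.
intros Hr HP HG j.
pose proof (powser_minus _ _ r _ _ HP (powser_scal mu _ _ _ (powser_mult _ _ r _ _ Hr HP (powser_Cexp (RtoC h) r)))) as X.
pose proof (powser_unique _ _ r _ _ Hr X (powser_id r)) as U.
rewrite (csum_ext _ (fun i => P i * (RtoC (/ INR (fact (j - i))) * RtoC h ^ (j - i)))%C).
- etransitivity; [apply U|destruct j as [|[|j]]; reflexivity].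
  intros z _ Hz; cbv beta; rewrite <- (HG z Hz) at 4; ring.
- intros i _; f_equal; unfold Rdiv; rewrite RtoC_mult, RtoC_pow; ring.
Qed.

(** Taylor coefficients at a removable singularity are unique, so the chosen
    expansion is the given one. *)
Lemma egf_coef_eq f c n : is_taylor_at0 f c -> egf_coef f n = (RtoC (INR (fact n)) * c n)%C.
Proof.
intros H; unfold egf_coef; f_equal.
assert (E : is_taylor_at0 f (epsilon (inhabits (fun _ : nat => RtoC 0)) (is_taylor_at0 f)))
  by (apply epsilon_spec; exists c; auto).
revert E; generalize (epsilon (inhabits (fun _ : nat => RtoC 0)) (is_taylor_at0 f)); intros d [r' [Hr' Hd]].
destruct H as [r [Hr Hc]].
set (r0 := Rmin r r').
assert (rho : 0 < r0) by (apply Rmin_pos; auto).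
pose proof (Rmin_l r r') as L1; pose proof (Rmin_r r r') as L2; fold r0 in L1, L2.
(* The value of [f] at [0] is unconstrained and is replaced by the constant coefficient. *)
set (ext := fun (e : nat -> C) z => if excluded_middle_informative (z = RtoC 0) then e 0%nat else f z).
assert (X : forall e r1, r0 <= r1 -> (forall t, t <> RtoC 0 -> Cmod t < r1 ->
  is_pseries (K := C_AbsRing) (V := C_NormedModule) e t (f t)) -> powser e r0 (ext e)).
{ intros e r1 L He z Hz; unfold ext; destruct (excluded_middle_informative (z = RtoC 0)) as [E|E].
  - rewrite E; eapply cseries_eq; [|apply (cseries_finite _ 1)]; [simpl; ring|].
    intros [|k] Hk; [lia|simpl; ring].
  - apply (proj1 (is_pseries_C e z (f z))), He; auto; lra. }
apply (powser_unique d c r0 (ext d) (ext c) rho (X d r' ltac:(auto) Hd) (X c r ltac:(auto) Hc)).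
intros z z0 _; unfold ext; destruct (excluded_middle_informative (z = RtoC 0)); [contradiction|reflexivity].
Qed.

Lemma taylor_generating mu h P r G (w y : nat -> C) q f : 0 < r -> powser P r G ->
  (forall t, Cmod t < r -> G t * (1 - mu * Cexp (RtoC h * t)) = t)%C ->
  (forall t, t <> RtoC 0 -> Cmod t < r -> (1 - mu * Cexp (RtoC h * t))%C <> RtoC 0) ->
  (forall t, t <> RtoC 0 -> f t = csum (fun i => w i * t * Cexp (y i * t) / (mu * Cexp (RtoC h * t) - 1))%C q) ->
  is_taylor_at0 f (fun n => - csum (fun i => w i *
     csum (fun j => P j * (RtoC (/ INR (fact (n - j))) * y i ^ (n - j))) (S n)) q)%C.
Proof.
intros Hr HP HG HN Hf; exists r; split; auto; intros t t0 Ht; apply is_pseries_C.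
pose proof (powser_scal (-(1))%C _ _ _ (powser_csum _ r (fun i z => w i * (G z * Cexp (y i * z)))%C q
  (fun i _ => powser_scal (w i) _ _ _ (powser_mult _ _ r _ _ Hr HP (powser_Cexp (y i) r)))) t Ht) as X.
eapply cseries_ext; [|eapply cseries_eq; [|exact X]].
- intros n; cbv beta; ring.
- cbv beta; rewrite Hf by auto; rewrite <- csum_scal; apply csum_ext; intros i _.
  rewrite <- (HG t Ht) at 3; field.
  intros E; apply (HN t t0 Ht). 
  replace (1 - mu * Cexp (RtoC h * t))%C with (- (mu * Cexp (RtoC h * t) - 1))%C by ring.
  rewrite E; ring.
Qed.

(** * The identity theorem *)

Lemma analytic_at_powser F z0 : analytic_at F z0 <->
  exists c r, 0 < r /\ powser c r (fun z => F (z0 + z))%C.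
Proof.
split; intros (c & r & Hr & H); exists c, r; split; auto; intros z Hz.
- apply (proj1 (is_pseries_C c z (F (z0 + z)%C))); replace z with (z0 + z - z0)%C at 1 by ring; apply H.
  replace (z0 + z - z0)%C with z by ring; auto.
- replace (F z) with (F (z0 + (z - z0)))%C by (f_equal; ring); apply (proj2 (is_pseries_C c (z - z0) (F (z0 + (z - z0))%C))), H; auto.
Qed.

Lemma analytic_at_minus F G z0 : analytic_at F z0 -> analytic_at G z0 ->
  analytic_at (fun z => F z - G z)%C z0.
Proof.
rewrite !analytic_at_powser; intros (c & r & Hr & H) (d & r' & Hr' & H').
exists (fun k => c k - d k)%C, (Rmin r r'); split; [apply Rmin_pos; auto|].
apply (powser_minus c d); [apply powser_sub with r|apply powser_sub with r']; auto using Rmin_l, Rmin_r.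
Qed.

(** Let [T] be the supremum of the times up to which [D] vanishes along the segment.
    The zeros before [T] accumulate at the point of time [T], so that the power series
    there vanishes, and [D] with it for some time beyond [T] unless [T = 1]. *)
Lemma identity_segment (D : C -> C) (p v : C) : v <> RtoC 0 ->
  (forall t, 0 <= t <= 1 -> analytic_at D (p + RtoC t * v)) ->
  (exists d, 0 < d <= 1 /\ forall t, 0 <= t <= d -> D (p + RtoC t * v)%C = RtoC 0) ->
  D (p + v)%C = RtoC 0.
Proof.
intros Hv HA (d & Hd & HD); pose proof (proj1 (Cmod_gt_0 v) Hv) as Pv.
set (E := fun t => 0 <= t <= 1 /\ forall s, 0 <= s <= t -> D (p + RtoC s * v)%C = RtoC 0).
destruct (completeness E) as [T [UB LUB]].
{ exists 1; intros t [Ht _]; lra. }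
{ exists 0; split; [lra|]; intros s Hs; apply HD; lra. }
assert (HT : d <= T) by (apply UB; split; auto; lra).
assert (HT1 : T <= 1) by (apply LUB; intros t [Ht _]; lra).
assert (Z : forall t, 0 <= t < T -> D (p + RtoC t * v)%C = RtoC 0).
{ intros t Ht; destruct (excluded_middle_informative (exists s, E s /\ t < s)) as [[s [[_ Hs] L]]|N].
  - apply Hs; lra.
  - exfalso; assert (T <= t); [|lra].
    apply LUB; intros s Hs; apply Rnot_lt_le; intros L; apply N; exists s; auto. }
destruct (proj1 (analytic_at_powser D (p + RtoC T * v)) (HA T ltac:(lra))) as (c & r & Hr & Hc).
assert (C0 : forall k, c k = RtoC 0).
{ apply (powser_zero c r _ Hr Hc); intros eps He.
  (* The zero of time [T - e] lies at distance less than [eps]. *)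
  set (e := Rmin T (eps / Cmod v) / 2).
  assert (0 < eps / Cmod v) by (apply Rdiv_lt_0_compat; auto).
  pose proof (Rmin_l T (eps / Cmod v)); pose proof (Rmin_r T (eps / Cmod v)).
  assert (0 < Rmin T (eps / Cmod v)) by (apply Rmin_pos; lra).
  exists (- RtoC e * v)%C; split; [|split].
  - apply Cmult_neq_0; auto; rewrite <- RtoC_opp; apply RtoC_neq; unfold e; lra.
  - rewrite Cmod_mult, Cmod_opp, Cmod_R, Rabs_pos_eq by (unfold e; lra).
    apply Rlt_le_trans with (eps / Cmod v * Cmod v); [|right; field; lra].
    apply Rmult_lt_compat_r; unfold e; lra.
  - rewrite <- (Z (T - e)) by (unfold e; lra); f_equal; rewrite RtoC_minus; ring. }
assert (Y : forall t, Rabs (t - T) * Cmod v < r -> D (p + RtoC t * v)%C = RtoC 0).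
{ intros t Ht; rewrite <- Cmod_R, <- Cmod_mult in Ht.
  replace (p + RtoC t * v)%C with (p + RtoC T * v + RtoC (t - T) * v)%C by (rewrite RtoC_minus; ring).
  apply cseries_unique with (1 := Hc _ Ht).
  eapply cseries_eq; [|apply (cseries_finite _ 0)]; [reflexivity|].
  intros k _; rewrite C0; ring. }
assert (HT' : T = 1).
{ apply Rle_antisym; auto; apply Rnot_lt_le; intros L.
  set (e := r / Cmod v / 2); assert (0 < r / Cmod v) by (apply Rdiv_lt_0_compat; auto).
  assert (B : forall t, T <= t <= T + e -> D (p + RtoC t * v)%C = RtoC 0).
  { intros t Ht; apply Y; rewrite Rabs_pos_eq by lra.
    apply Rlt_le_trans with (r / Cmod v * Cmod v); [|right; field; lra].
    apply Rmult_lt_compat_r; unfold e in *; lra. }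
  pose proof (Rmin_l 1 (T + e)); pose proof (Rmin_r 1 (T + e)).
  assert (Rmin 1 (T + e) <= T).
  { apply UB; split.
    - split; [apply Rmin_glb; unfold e; lra|lra].
    - intros s Hs; destruct (Rlt_le_dec s T); [apply Z|apply B]; lra. }
  assert (T < Rmin 1 (T + e)) by (apply Rmin_glb_lt; unfold e; lra); lra. }
replace (p + v)%C with (p + RtoC 1 * v)%C by ring; apply Y.
rewrite HT', Rminus_diag, Rabs_R0; lra.
Qed.

(** Every [w] with [Re w <= 1] other than [1] is joined to the half-plane of
    convergence by a segment avoiding [1], starting from [2 + i] or [2 - i]
    according to the sign of [Im w]. *)
Lemma is_berndt_L_unique q x a chi F1 F2 w : is_berndt_L q x a chi F1 -> is_berndt_L q x a chi F2 ->
  w <> RtoC 1 -> F1 w = F2 w.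
Proof.
intros [S1 A1] [S2 A2] Hw; apply Ceq_minus.
assert (Z : forall s, 1 < Re s -> (F1 s - F2 s)%C = RtoC 0).
{ intros s Hs; rewrite (cseries_unique _ _ _ (S1 s Hs) (S2 s Hs)); ring. }
destruct (Rlt_le_dec 1 (Re w)) as [L|L]; [apply Z; auto|].
set (e := if Rle_dec 0 (Im w) then 1 else -1).
set (p := (2, e) : C).
replace w with (p + (w - p))%C by ring.
apply (identity_segment (fun s => F1 s - F2 s)%C).
- intros E; apply (f_equal Re) in E; rewrite Re_minus in E; simpl in E; lra.
- intros t Ht; assert (N : (p + RtoC t * (w - p))%C <> RtoC 1).
  { intros E; pose proof (f_equal Re E) as ER; pose proof (f_equal Im E) as EI.
    destruct w as [w1 w2]; unfold p in ER, EI; simpl in ER, EI, L.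
    assert (e = 1 /\ 0 <= w2 \/ e = -1 /\ w2 < 0).
    { unfold e; simpl; destruct (Rle_dec 0 w2); lra. }
    assert (t = 1) by nra.
    subst t; apply Hw; unfold RtoC; f_equal; lra. }
  apply analytic_at_minus; auto.
- exists (Rmin 1 (1 / (2 * (3 - Re w)))).
  assert (0 < 1 / (2 * (3 - Re w))) by (apply Rdiv_lt_0_compat; lra).
  pose proof (Rmin_l 1 (1 / (2 * (3 - Re w)))); pose proof (Rmin_r 1 (1 / (2 * (3 - Re w)))).
  split; [split; [apply Rmin_pos; lra|lra]|].
  intros t Ht; apply Z.
  assert (t * (2 * (3 - Re w)) <= 1).
  { apply Rle_trans with (1 / (2 * (3 - Re w)) * (2 * (3 - Re w))).
    - apply Rmult_le_compat_r; lra.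
    - right; field; lra. }
  destruct w as [w1 w2]; unfold p; simpl in *; nra.
Qed.

(** * Continuation and special values of the L-function *)

Lemma csum_blocks (a : nat -> C) q M :
  csum (fun m => csum (fun r => a (q * m + r)%nat) q) M = csum a (q * M).
Proof.
induction M as [|M IH]; [rewrite Nat.mul_0_r; reflexivity|].
simpl csum; rewrite IH, Nat.mul_succ_r, csum_add; reflexivity.
Qed.

Lemma cseries_blocks (a : nat -> C) (l : C) q : (1 <= q)%nat -> cseries a l ->
  cseries (fun m => csum (fun r => a (q * m + r)%nat) q) l.
Proof.
intros Hq H; apply cseries_eps; intros eps He; destruct (proj1 (cseries_eps a l) H eps He) as [N HN].
exists N; intros n Hn; rewrite csum_blocks; apply HN; nia.
Qed.

Section Berndt.

Variables (q : nat) (x a : R) (chi : Z -> C).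
Hypothesis hq : (1 <= q)%nat.
Hypothesis ha : 0 < a.
Hypothesis hchi : dirichlet_character q chi.

Let lam : C := Cexp (2 * RtoC PI * Ci * RtoC x / RtoC (INR q))%C.
Let mu : C := (lam ^ q)%C.
Let h : R := INR q.
Let weight (r : nat) : C := (chi (Z.of_nat r) * lam ^ r)%C.

Lemma modulus_pos : 0 < h.
Proof. apply lt_0_INR; lia. Qed.

Lemma lam_circle : Cmod lam = 1.
Proof.
unfold lam; rewrite Cmod_Cexp.
replace (Re _) with 0; [apply exp_0|].
replace (2 * RtoC PI * Ci * RtoC x / RtoC (INR q))%C with (Ci * RtoC (2 * PI * x / INR q))%C.
- simpl; ring.
- pose proof modulus_pos as Hh; unfold h in Hh.
  unfold Rdiv; rewrite !RtoC_mult, RtoC_inv by lra; unfold Cdiv; ring.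
Qed.

Lemma mu_circle : Cmod mu = 1.
Proof. unfold mu; rewrite Cmod_pow, lam_circle, pow1; reflexivity. Qed.

Lemma chi_block m r : chi (Z.of_nat (q * m + r)) = chi (Z.of_nat r).
Proof.
induction m as [|m IH]; [now rewrite Nat.mul_0_r|].
replace (Z.of_nat (q * S m + r)) with (Z.of_nat (q * m + r) + Z.of_nat q)%Z by lia.
rewrite dirichlet_periodic with (1 := hchi); exact IH.
Qed.

(** Along a residue class modulo [q] the character is constant and the exponential
    is geometric of ratio [mu = lam ^ q]. *)
Lemma berndt_term_block s m r : s <> RtoC 1 ->
  berndt_term q x a chi s (q * m + r) =
  (weight r / (1 - s) * (mu ^ m * pow_deriv 1 (1 - s) (node h (INR r + a) m)))%C.
Proof.
intros Hs; assert (N : (1 - s)%C <> RtoC 0) by (apply Cminus_eq_contra; auto).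
unfold berndt_term; rewrite chi_block.
replace (2 * RtoC PI * Ci * RtoC (INR (q * m + r)) * RtoC x / RtoC (INR q))%C with
 (RtoC (INR (q * m + r)) * (2 * RtoC PI * Ci * RtoC x / RtoC (INR q)))%C by (unfold Cdiv; ring).
rewrite <- Cexp_pow; fold lam; rewrite Cpow_add_r, Cpow_mult_r; fold mu.
replace (INR (q * m + r) + a) with (node h (INR r + a) m)
  by (unfold node, h; rewrite plus_INR, mult_INR; ring).
unfold pow_deriv; simpl falling; simpl INR.
(* The derivative of [u ^ (1 - s)] is [(1 - s) * u ^ (- s)]. *)
replace (1 - s - 1)%C with (- s)%C by ring; rewrite Rcpow_opp; unfold weight.
field; split; [apply Cexp_nonzero|auto].
Qed.

Lemma ex_berndt_series s : 1 < Re s -> exists l : C, cseries (berndt_term q x a chi s) l.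
Proof.
intros Hs; set (B := rsum (fun r => Cmod (chi (Z.of_nat r))) q).
apply ex_cseries_le with (fun k => B * Rpower (a + 1 * INR k) (- Re s)).
- intros k; unfold berndt_term.
  rewrite (Nat.div_mod k q) at 1 by lia; rewrite chi_block.
  replace (2 * RtoC PI * Ci * RtoC (INR k) * RtoC x / RtoC (INR q))%C with
   (RtoC (INR k) * (2 * RtoC PI * Ci * RtoC x / RtoC (INR q)))%C by (unfold Cdiv; ring).
  rewrite <- Cexp_pow; fold lam; unfold Cdiv; rewrite <- Rcpow_opp.
  rewrite !Cmod_mult, Cmod_pow, lam_circle, pow1, Rmult_1_r, Cmod_Rcpow.
  replace (a + 1 * INR k) with (INR k + a) by ring.
  apply Rmult_le_compat_r; [left; apply Rpower_pos|].
  apply (rsum_le_term (fun r => Cmod (chi (Z.of_nat r)))); [intros; apply Cmod_ge_0|].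
  apply Nat.mod_upper_bound; lia.
- apply ex_rseries_scal, ex_series_Rpower_progression; lra.
Qed.

Variables (P : nat -> C) (rad : R) (G : C -> C).
Hypothesis Hrad : 0 < rad.
Hypothesis HPG : powser P rad G.
Hypothesis HG : forall t, Cmod t < rad -> (G t * (1 - mu * Cexp (RtoC h * t)) = t)%C.

(** The series is split by residues [r] modulo [q]. The quotient by [1 - s] turns
    the derivative [(1 - s) * u ^ (- s)] of [u ^ (1 - s)], which the
    regularisation sums, into [u ^ (- s)]. *)
Definition berndt_continuation (s : C) : C :=
  csum (fun r => weight r / (1 - s) * em_value mu h (INR r + a) P (1 - s))%C q.

Lemma shift_pos r : 0 < INR r + a.
Proof. generalize (pos_INR r); lra. Qed.

Let HP := kernel_recurrence mu h P rad G Hrad HPG HG.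

Lemma berndt_continuation_is_L : is_berndt_L q x a chi berndt_continuation.
Proof.
split.
- intros s Hs; destruct (ex_berndt_series s Hs) as [l Hl].
  assert (s1 : s <> RtoC 1) by (intros E; rewrite E, re_RtoC in Hs; lra).
  replace (berndt_continuation s) with l; [exact Hl|].
  apply cseries_unique with (1 := cseries_blocks _ _ q hq Hl).
  eapply cseries_ext; [|apply (cseries_csum (fun r m => weight r / (1 - s) *
    (mu ^ m * pow_deriv 1 (1 - s) (node h (INR r + a) m)))%C)].
  + intros m; apply csum_ext; intros r _; rewrite berndt_term_block; auto.
  + intros r _; apply cseries_scal, em_value_series; auto using mu_circle, modulus_pos, shift_pos.
    rewrite Re_minus, re_RtoC; lra.
- intros s Hs; apply analytic_at_powser.
  assert (N : (1 - s - 0)%C <> RtoC 0).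
  { replace (1 - s - 0)%C with (1 - s)%C by ring; apply Cminus_eq_contra; auto. }
  destruct (powser_inv _ 1 _ Rlt_0_1 (powser_minus _ _ 1 _ _ (powser_const (1 - s)%C 1) (powser_id 1)) N)
    as (r & e & Hr & _ & He).
  assert (X : expandable r (fun z => berndt_continuation (s + z))); [|destruct X as [c Hc]; exists c, r; split; auto; lra].
  apply (expandable_csum r (fun i z => weight i / (1 - (s + z)) * em_value mu h (INR i + a) P (1 - (s + z)))%C).
  intros i _; apply expandable_ext with
    (fun z => weight i * / (1 - s - z) * em_value mu h (INR i + a) P (1 - s - z))%C.
  + intros z _; replace (1 - (s + z))%C with (1 - s - z)%C by ring; reflexivity.
  + apply (expandable_mult r (fun z => weight i * / (1 - s - z))%C); [lra| |].
    { apply (expandable_mult r (fun _ => weight i)); [lra|apply expandable_const|exists e; exact He]. }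
    apply expandable_em_value; auto using mu_circle, modulus_pos, shift_pos; lra.
Qed.

Lemma berndt_continuation_value n : (1 <= n)%nat ->
  berndt_continuation (1 - RtoC (INR n)) =
  (RtoC (INR (fact n)) / RtoC (INR n) * csum (fun r => weight r *
     csum (fun j => P j * (RtoC (/ INR (fact (n - j))) * RtoC (INR r + a) ^ (n - j))) (S n)) q)%C.
Proof.
intros Hn; unfold berndt_continuation.
assert (N : RtoC (INR n) <> RtoC 0) by (apply RtoC_neq, not_0_INR; lia).
replace (1 - (1 - RtoC (INR n)))%C with (RtoC (INR n)) by ring.
rewrite <- csum_scal; apply csum_ext; intros r _.
rewrite (em_value_nat mu h (INR r + a) P); auto using mu_circle, modulus_pos, shift_pos.
rewrite (csum_ext _ (fun j => P j * (RtoC (/ INR (fact (n - j))) * RtoC (INR r + a) ^ (n - j)))%C (S n)).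
- field; auto.
- intros j _; f_equal; unfold Rdiv; rewrite RtoC_mult, RtoC_pow; ring.
Qed.

Hypothesis HGN : forall t, t <> RtoC 0 -> Cmod t < rad -> (1 - mu * Cexp (RtoC h * t))%C <> RtoC 0.

Lemma berndt_L_value n f : (1 <= n)%nat ->
  (forall t, t <> RtoC 0 -> f t =
     csum (fun r => weight r * t * Cexp (RtoC (INR r + a) * t) / (mu * Cexp (RtoC h * t) - 1))%C q) ->
  berndt_L q x a chi (1 - RtoC (INR n))%C = (- (egf_coef f n / RtoC (INR n)))%C.
Proof.
intros Hn Hf.
assert (N : RtoC (INR n) <> RtoC 0) by (apply RtoC_neq, not_0_INR; lia).
rewrite (is_berndt_L_unique q x a chi _ berndt_continuation).
- rewrite berndt_continuation_value by auto.
  rewrite (egf_coef_eq f _ n (taylor_generating mu h P rad G weight (fun r => RtoC (INR r + a)) q f Hrad HPG HG HGN Hf)).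
  field; auto.
- unfold berndt_L; apply epsilon_spec; exists berndt_continuation; apply berndt_continuation_is_L.
- apply berndt_continuation_is_L.
- intros E; apply N; transitivity (1 - (1 - RtoC (INR n)))%C; [ring|rewrite E; ring].
Qed.

End Berndt.

Lemma csum_shift (f : nat -> C) q : f 0%nat = f q -> csum (fun r => f (S r)) q = csum f q.
Proof.
intros E; transitivity (csum f (S q) - f 0%nat)%C; [rewrite csum_S_head; ring|].
simpl; rewrite E; ring.
Qed.

Lemma sum_n_m_csum (f : nat -> C) q : (1 <= q)%nat ->
  sum_n_m (G := C_AbelianMonoid) f 1 q = csum (fun r => f (S r)) q.
Proof.
induction q as [|q IH]; intros Hq; [lia|].
destruct q as [|q]; [rewrite sum_n_n; simpl; ring|].
rewrite sum_n_Sm by lia; rewrite IH by lia; reflexivity.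
Qed.

Theorem theorem2p6 (n q : nat) (x a : R) (chi : Z -> C)
  (hn : (1 <= n)%nat) (hq : (1 <= q)%nat) (ha : (0 < a)%R)
  (hchi : dirichlet_character q chi) :
  (q = 1%nat ->
     berndt_L q x a chi (1 - RtoC (INR n))%C =
     (- (apostol_bernoulli n (RtoC a)
           (Cexp (2 * RtoC PI * Ci * RtoC x / RtoC (INR q))) / RtoC (INR n)))%C) /\
  ((2 <= q)%nat ->
     berndt_L q x a chi (1 - RtoC (INR n))%C =
     (- (gen_apostol_bernoulli n q chi (RtoC a)
           (Cexp (2 * RtoC PI * Ci * RtoC x / RtoC (INR q))) / RtoC (INR n)))%C).
Proof.
set (lam := Cexp (2 * RtoC PI * Ci * RtoC x / RtoC (INR q))).
destruct (bernoulli_kernel (lam ^ q)%C (INR q)) as (P & rad & G & Hrad & HPG & HG & HGN).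
{ apply lt_0_INR; lia. }
split; intros Hq.
- apply (berndt_L_value q x a chi hq ha hchi P rad G Hrad HPG HG HGN n); auto.
  intros t _; fold lam; subst q; simpl csum; simpl INR.
  (* Modulo [1] the integer [0] is a unit, so [chi 0] is a nonzero idempotent. *)
  assert (C1 : chi 0%Z = RtoC 1).
  { assert (C0 : chi 0%Z <> RtoC 0).
    { intros E; apply (dirichlet_zero 1 chi hchi 0) in E; apply E; reflexivity. }
    pose proof (dirichlet_mult 1 chi hchi 0 0) as M; simpl in M.
    transitivity (chi 0%Z * chi 0%Z / chi 0%Z)%C; [field; auto|rewrite <- M; field; auto]. }
  rewrite C1, Rplus_0_l, Cplus_0_l, !Cmult_1_r, !Cmult_1_l; reflexivity.
- apply (berndt_L_value q x a chi hq ha hchi P rad G Hrad HPG HG HGN n); auto.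
  intros t _; fold lam.
  (* For [q >= 2] the residues [0] and [q] carry no weight, so that the sums over [0 <= r < q] and [1 <= r <= q] agree. *)
  assert (Z : forall k, Z.gcd k (Z.of_nat q) = Z.of_nat q -> chi k = RtoC 0).
  { intros k E; apply (dirichlet_zero q chi hchi k); rewrite E; lia. }
  rewrite sum_n_m_csum by auto.
  rewrite (csum_shift (fun r => chi (Z.of_nat r) * lam ^ r * t * Cexp ((RtoC (INR r) + RtoC a) * t) /
       (lam ^ q * Cexp (RtoC (INR q) * t) - 1))%C).
  + apply csum_ext; intros r _; rewrite RtoC_plus; reflexivity.
  + rewrite (Z (Z.of_nat 0)), (Z (Z.of_nat q)).
    * unfold Cdiv; ring.
    * rewrite Z.gcd_diag; lia.
    * simpl; lia.
Qed.
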